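(* Let $k,r,d,m\in\mathbb{N}$ satisfy $3\leq k\leq d$, $1\leq m\leq d+1$, $2\leq r\leq \frac{d+2}{2}$, and for each integer $1\leq j<k$ let $\alpha_j\in [0,j]$ be a real number. Let $K>0$. Define $$s=\max\left(\frac{d+1}{2},\ d-r+1,\ \max_{1\leq j<k}\frac{d+j+r-3}{2+j-\alpha_j},\ k-1\right).$$ There exists a constant $C>0$, depending only on $k,r,d,m,\max_j \alpha_j,\min_j\alpha_j$ and $K$, such that the following holds for every odd prime power $q$, every $t\in\mathbb{F}_q\setminus\{0\}$ and every $E\subset\mathbb{F}_q^d$. Suppose that for every $1\leq j<k$, $$\left|\left\{B\in \binom{E}{j}:1<\operatorname{aff}(\widetilde{N}(B))<r \text{ and } |\widetilde{N}(B)|>m \right\}\right|\leq K |E|^{\alpha_j}.$$ If $|E|>Cq^{s}$, then the $t$-distance graph $G_t(E)$ has VC-dimension at least $k$.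
   Context: For $x,y\in\mathbb{F}_q^d$ write $\|x-y\|=\sum_{i=1}^d (x_i-y_i)^2\in\mathbb{F}_q$. For $E\subset\mathbb{F}_q^d$ and $t\in\mathbb{F}_q$, the $t$-distance graph $G_t(E)$ is the graph with vertex set $E$ in which $x\sim y$ if and only if $\|x-y\|=t$. With $E$ and $t$ fixed, $N(x)=\{y\in E:x\sim y\}$ denotes the neighborhood of $x$ in $G_t(E)$, and for $S\subset E$, $\widetilde{N}(S)=\bigcap_{x\in S}N(x)$ is the set of common neighbors. $\binom{E}{j}$ denotes the set of $j$-element subsets of $E$. For a set $F\subset\mathbb{F}_q^d$, $\operatorname{aff}(F)$ is the maximum number of affinely independent points in $F$ (equivalently, $\operatorname{aff}(F)-1$ is the dimension of the affine span of $F$). VC-dimension: if $V$ is a set and $\mathcal{H}\subset\{0,1\}^V$ is a family of functions, $\mathcal{H}$ shatters a finite set $S\subset V$ if $\{0,1\}^S=\{h|_S:h\in\mathcal{H}\}$; the VC-dimension of $\mathcal{H}$ is the largest $n$ such that $\mathcal{H}$ shatters some set of size $n$ (infinite if no such $n$ exists). For a graph $G$ with vertex set $V$, let $N[x]=\{x\}\cup N(x)$ be the closed neighborhood of $x\in V$. The VC-dimension of the graph $G$ is the VC-dimension of the family $\{\mathbf{1}_{N[x]}:x\in V\}$ of indicator functions. *)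

(* Defs.v *)
From HB Require Import structures.
From mathcomp Require Import all_boot all_order all_algebra.
From mathcomp Require Import reals exp.

Set Implicit Arguments.
Unset Strict Implicit.
Unset Printing Implicit Defensive.

Import Order.TTheory GRing.Theory Num.Theory.
Local Open Scope ring_scope.

Section VCDimension.
Variable V : finType.

Definition restriction (S : {set V}) (h : {ffun V -> bool}) :
    {ffun {x | x \in S} -> bool} :=
  [ffun x => h (val x)].

Definition shatters (H : {set {ffun V -> bool}}) (S : {set V}) : bool :=
  [set restriction S h | h in H] == [set: {ffun {x | x \in S} -> bool}].

(* V is finite, so the VC-dimension is a maximum over the subsets of V and
   never infinite; the empty family, which shatters nothing, gets value 0. *)
Definition vc_dim (H : {set {ffun V -> bool}}) : nat :=
  \max_(S : {set V} | shatters H S) #|S|.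

End VCDimension.

Section Graph.
Variables (V : finType) (e : rel V).

Definition neighborhood (x : V) : {set V} := [set y | e x y].

Definition closed_neighborhood (x : V) : {set V} := x |: neighborhood x.

Definition common_neighbors (S : {set V}) : {set V} :=
  \bigcap_(x in S) neighborhood x.

Definition graph_vc_dim : nat :=
  vc_dim [set [ffun y => y \in closed_neighborhood x] | x : V].

End Graph.

Section FiniteSpace.
Variables (F : finFieldType) (d : nat).

Definition affinely_independent (A : {set 'rV[F]_d}) : bool :=
  [forall c : {ffun 'rV[F]_d -> F},
    (\sum_(x in A) c x == 0) && (\sum_(x in A) c x *: x == 0)
    ==> [forall x in A, c x == 0]].

Definition aff (A : {set 'rV[F]_d}) : nat :=
  \max_(B : {set 'rV[F]_d} | (B \subset A) && affinely_independent B) #|B|.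

Definition qnorm (x : 'rV[F]_d) : F := \sum_(i < d) x 0 i ^+ 2.

Definition distance_graph (E : {set 'rV[F]_d}) (t : F) :
    rel {x : 'rV[F]_d | x \in E} :=
  fun x y => qnorm (val x - val y) == t.

Arguments distance_graph : clear implicits.

Definition exceptional_sets (E : {set 'rV[F]_d}) (t : F) (r m j : nat) :
    {set {set {x : 'rV[F]_d | x \in E}}} :=
  [set B : {set {x : 'rV[F]_d | x \in E}} |
    let NB := common_neighbors (distance_graph E t) B in
    [&& #|B| == j, (1 < aff (val @: NB) < r)%N & (m < #|NB|)%N]].

End FiniteSpace.

Arguments distance_graph {F d} E t.

Section Exponent.
Variable R : realType.

(* Maximum and minimum of f over 1 <= j < k, for k >= 2: the default value f 1
   of the iterated operation is itself one of the terms. *)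
Definition max_upto (k : nat) (f : nat -> R) : R :=
  \big[Num.max/f 1%N]_(1 <= j < k) f j.

Definition min_upto (k : nat) (f : nat -> R) : R :=
  \big[Num.min/f 1%N]_(1 <= j < k) f j.

Definition vc_exponent (k r d : nat) (alpha : nat -> R) : R :=
  Num.max ((d%:R + 1) / 2)
    (Num.max (d%:R - r%:R + 1)
      (Num.max (max_upto k (fun j =>
                  (d%:R + j%:R + r%:R - 3) / (2 + j%:R - alpha j)))
        (k%:R - 1))).

End Exponent.

(* Main.v *)
(** Let n = |E|.  By Fourier analysis and the Weil bound for Kloosterman sums (Salie sums in odd
    dimension), the hypothesis n > C q^((d+1)/2) makes at least half of the vertices y have
    degree of order n/q.  Kloosterman sums are bounded by Stepanov's method over a large
    extension field, combined with the relation Kl(K2) = 2|K| - Kl(K)^2 between the Kloosterman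
    sums of a field K and of its quadratic extension K2.

    Inside the neighborhood of each such y there is a cluster P, of size of order n/q, such that
    every vertex z is adjacent either to all of P or to a tiny fraction of P: restrict the
    neighborhood repeatedly to the neighbors of some z in between.  Each restriction raises the
    affine rank of the set of common neighbors of P, and this rank stays below r because r
    affinely independent points with 2r <= d+2 have at most 2 q^(d-r) common neighbors, which is
    less than |P|.

    A random k-tuple in P is shattered unless, for some nonempty proper subset B of it, all common
    neighbors of B are adjacent to all of P.  Such a B has either at most m common neighbors or is
    exceptional.  The pairs (y, B) of the first kind are too few because n > C q^(k-1), and those
    of the second kind are too few by the hypothesis on exceptional sets. *)

Require Import Defs.
From HB Require Import structures.
From mathcomp Require Import all_boot all_order all_algebra.
From mathcomp Require Import all_fingroup all_field all_character.
From mathcomp Require Import reals exp.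
From mathcomp Require Import zify ring lra.

Set Implicit Arguments.
Unset Strict Implicit.
Unset Printing Implicit Defensive.

Import Order.TTheory GRing.Theory Num.Theory.
Local Open Scope ring_scope.

(** * Stepanov's method *)

(** Each entry of the exponent guards one step of the count. The entry d - r + 1 makes a cluster, of
    order n/q, exceed 2 q^(d-r). The quotient comes from the pairs (y, B) with B exceptional of size
    j. There are at most K n^(alpha_j) q^(r-2) of them, a failure of shattering needs of order n
    (n/q)^j of them, and they occur only when n is at most of order q^(d-1). Multiplying the last
    two bounds gives n^(j+2) <= c q^(d+j+r-3) n^(alpha_j).

    Stepanov's method enters only in a crude form that loses a factor 5q. This is harmless: along a
    chain of quadratic extensions the recursion for Kloosterman sums multiplies the relative excess
    over the Weil bound by at least 4 at every step, while the loss does not grow. A tall enough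
    chain therefore excludes any excess. *)

(** The products [V u * M u] occupy disjoint windows of [D] consecutive degrees, starting at
    [D * (u + e)], so the highest nonzero one has nothing to cancel against. *)
Lemma sum_monic_mul_eq0 (L : fieldType) (D e N : nat) (V M : nat -> {poly L}) :
  (forall u, (size (V u) <= D)%N) -> (forall u, (u < N)%N -> M u \is monic) ->
  (forall u, (u < N)%N -> size (M u) = (D * (u + e)).+1) ->
  \sum_(u < N) V u * M u = 0 -> forall u, (u < N)%N -> V u = 0.
Proof.
move=> sV; elim: N => [|N IH] mM sM //.
rewrite big_ord_recr /= => s0.
have small : (size (\sum_(u < N) V u * M u)%R <= D * (N + e))%N.
  apply: (leq_trans (size_sum _ _ _)); apply/bigmax_leqP => u _.
  have uN : (u < N.+1)%N by exact: ltn_trans (ltn_ord u) _.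
  apply: (leq_trans (size_polyMleq _ _)); rewrite sM // addnS /=.
  apply: (@leq_trans (D + D * (u + e))); first by rewrite leq_add2r.
  by rewrite -mulnS leq_mul2l -addSn leq_add2r ltn_ord orbT.
have VN0 : V N = 0.
  apply/eqP; apply/negPn/negP => VN.
  have sT : size (V N * M N) = (size (V N) + D * (N + e))%N.
    by rewrite size_Mmonic // ?mM // sM // addnS.
  have : size (V N * M N) = size (\sum_(u < N) V u * M u).
    by rewrite -(size_polyN (V N * M N)); move/eqP: s0; rewrite addr_eq0 => /eqP->.
  move: small => /[swap] <-; rewrite sT.
  have : (0 < size (V N))%N by rewrite size_poly_gt0.
  by lia.
move: s0; rewrite VN0 mul0r addr0 => s0 u; rewrite ltnS leq_eqVlt => /orP[/eqP->//|].
apply: IH => // v vN; [apply: mM | apply: sM]; exact: ltn_trans vN _.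
Qed.

Section Stepanov.
Variables (L : finFieldType) (q h : nat) (a c : L).
Hypotheses (q_gt1 : (1 < q)%N) (h_gt0 : (0 < h)%N) (q_nat : [pchar L].-nat q).

Local Notation B := (q ^ h)%N.
Local Notation D := (q ^ h.-1)%N.

(* The sum over j < h is half of the trace of x + a/x from the field of order q^(2h) to the
   field of order q; the other half is its B-th power. *)
Definition half_trace (x : L) : L := \sum_(j < h) (x + a / x) ^+ (q ^ j).

(* X^D times half_trace, which clears the pole at 0. *)
Definition half_trace_num : {poly L} :=
  \sum_(j < h) ('X^(D + q ^ j) + (a ^+ (q ^ j)) *: 'X^(D - q ^ j)).

Local Notation W := half_trace_num.

Lemma pchar_nat_exp n : [pchar L].-nat (q ^ n)%N.
Proof. by rewrite pnatX q_nat. Qed.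

Lemma half_trace_numE x : x != 0 -> W.[x] = x ^+ D * half_trace x.
Proof.
move=> x0; rewrite /W horner_sum /half_trace mulr_sumr; apply: eq_bigr => j _.
have jD : (q ^ j <= D)%N.
  by rewrite leq_exp2l // -ltnS prednK // ltn_ord.
rewrite !hornerE exprDn_pchar ?pchar_nat_exp // mulrDr exprD; congr (_ + _).
by rewrite expr_div_n mulrCA exprB // unitfE.
Qed.

(** The leading term is the first monomial of [j = h - 1], where [q ^ j = D]. *)
Lemma half_trace_num_size_monic : W \is monic /\ size W = (2 * D).+1.
Proof.
have -> : W = 'X^(2 * D) + (\sum_(j < h.-1) 'X^(D + q ^ j)
             + \sum_(j < h) (a ^+ (q ^ j)) *: 'X^(D - q ^ j)).
  rewrite /W big_split /= addrA; congr (_ + _).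
  pose f j : {poly L} := 'X^(D + q ^ j).
  rewrite -(big_mkord xpredT f) -(big_mkord xpredT f) -[in LHS](prednK h_gt0).
  by rewrite big_nat_recr //= addrC /f addnn mul2n.
have D0 : (0 < D)%N by rewrite expn_gt0 ltnW.
have sz : (size (\sum_(j < h.-1) 'X^(D + q ^ j)
             + \sum_(j < h) (a ^+ (q ^ j)) *: 'X^(D - q ^ j) : {poly L})%R <= 2 * D)%N.
  apply: (leq_trans (size_polyD _ _)); rewrite geq_max; apply/andP; split.
    apply: (leq_trans (size_sum _ _ _)); apply/bigmax_leqP => j _.
    by rewrite size_polyXn mul2n -addnn ltn_add2l ltn_exp2l.
  apply: (leq_trans (size_sum _ _ _)); apply/bigmax_leqP => j _.
  apply: (leq_trans (size_scale_leq _ _)); rewrite size_polyXn.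
  have : (0 < q ^ j)%N by rewrite expn_gt0 ltnW.
  by lia.
split; last by rewrite size_polyDl size_polyXn.
by rewrite monicE lead_coefDl ?lead_coefXn // size_polyXn.
Qed.

(* The auxiliary polynomial is P = sum_u V_u X^(jB) W^i X^((q-1-i)D) with u = qj + i and
   deg V_u < D.  On the counted set X^(jB) and W^i agree, after raising to the power B, with
   X^j and (cX^D - W)^i, so P vanishes there as soon as sum_u V_u^B H_u = 0 identically.
   The map V |-> sum_u V_u^B H_u is additive, hence a nonzero such V exists by pigeonhole;
   P is then nonzero because its terms have distinct degrees. *)
Lemma stepanov_bound :
  (#|[set x : L | [&& x != 0, x ^+ (B * B) == x &
      half_trace x ^+ B == c - half_trace x]]%R| <= B * D + 4 * B)%N.
Proof.
have [mW sW] := half_trace_num_size_monic.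
have D0 : (0 < D)%N by rewrite expn_gt0 ltnW.
have BE : B = (q * D)%N by rewrite -{1}(prednK h_gt0) expnS.
(* The pigeonhole needs more unknowns, q D J, than the size bound [S] below, which is q D (D - 1) +
   J + 2 D (q - 1). The choice J = D + 3 achieves this for all q > 1 and costs only the term [4 * B]
   in the final bound. *)
set J := (D + 3)%N; set N := (q * J)%N.
pose M u := 'X^(u %/ q * B) * W ^+ (u %% q) * 'X^((q.-1 - u %% q) * D) : {poly L}.
pose H u := 'X^(u %/ q) * (c *: 'X^D - W) ^+ (u %% q) * 'X^((q.-1 - u %% q) * D) : {poly L}.
have q0 : (0 < q)%N by exact: ltnW.
have iq u : (u %% q <= q.-1)%N by rewrite -ltnS prednK // ltn_mod.
have mM u : M u \is monic by rewrite rpredM ?monicXn // rpredM ?monicXn // rpredX.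
have sM u : size (M u) = (D * (u + q.-1)).+1.
  have sWi i : size (W ^+ i) = (2 * D * i).+1.
    elim: i => [|i IHi]; first by rewrite expr0 size_poly1 muln0.
    by rewrite exprS size_monicM ?monic_neq0 ?rpredX // sW IHi; lia.
  have mWi i : W ^+ i \is monic by rewrite rpredX.
  rewrite size_Mmonic ?monicXn //; last by rewrite monic_neq0 // rpredM ?monicXn.
  rewrite size_monicM ?monicXn ?monic_neq0 // !size_polyXn sWi /=.
  rewrite BE; have := iq u; have := divn_eq u q.
  move: (u %/ q)%N (u %% q)%N => s r ur rq.
  rewrite -(subnK rq) ur addnK; move: (q.-1 - r)%N => r'; lia.
set S := (B * D.-1 + J + 2 * D * q.-1)%N.
have sH u : (u < N)%N -> (size (H u) <= J + 2 * D * q.-1)%N.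
  move=> uN.
  have s1 : (size (c *: 'X^D - W)%R <= (2 * D).+1)%N.
    apply: (leq_trans (size_polyD _ _)); rewrite size_polyN sW geq_max leqnn andbT.
    by apply: (leq_trans (size_scale_leq _ _)); rewrite size_polyXn; lia.
  have si i : (size ((c *: 'X^D - W) ^+ i) <= (2 * D * i).+1)%N.
    elim: i => [|i IHi]; first by rewrite expr0 size_poly1.
    by rewrite exprS; apply: (leq_trans (size_polyMleq _ _)); lia.
  apply: (leq_trans (size_polyMleq _ _)); rewrite size_polyXn addnS /=.
  have := size_polyMleq ('X^(u %/ q)) ((c *: 'X^D - W) ^+ (u %% q)).
  rewrite size_polyXn addSn /=.
  have uJ : (u %/ q < J)%N by rewrite ltn_divLR // mulnC.
  have := si (u %% q)%N.
  have := iq u; move: (u %% q)%N (u %/ q)%N uJ (size _) (size _) => i j jJ s t.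
  move=> iq1; rewrite -(subnK iq1) addnK; move: (q.-1 - i)%N => i' *; lia.
pose Phi (V : {ffun 'I_N -> 'rV[L]_D}) : {poly L} :=
  \sum_(u < N) rVpoly (V u) ^+ B * H u.
have sPhi V : (size (Phi V) <= S)%N.
  apply: (leq_trans (size_sum _ _ _)); apply/bigmax_leqP => u _.
  apply: (leq_trans (size_polyMleq _ _)).
  have := sH u (ltn_ord u).
  have : (size (rVpoly (V u) ^+ B) <= (D.-1 * B).+1)%N.
    apply: (leq_trans (size_poly_exp_leq _ _)); rewrite ltnS leq_mul2r; apply/orP; right.
    have : (size (rVpoly (V u)) <= D)%N by exact: size_poly.
    by move: (size _) => s; lia.
  rewrite /S; lia.
have /injectivePn[V1 [V2 nV eV]] : ~~ injectiveb (fun V => poly_rV (Phi V) : 'rV_S).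
  apply/negP => /injectiveP /leq_card; rewrite card_ffun !card_mx card_ord !mul1n -expnM.
  apply/negP; rewrite -ltnNge ltn_exp2l ?finNzRing_gt1 // /S /N /J BE.
  have : (1 < q)%N by []. have : (0 < D)%N by [].
  move: D => D'; case: D' => // D' _; case: q => // q' *; nia.
pose V u := if insub u is Some i then rVpoly (V1 i - V2 i) else 0.
have VE (u : 'I_N) : V u = rVpoly (V1 u) - rVpoly (V2 u).
  by rewrite /V valK linearB.
have pB : [pchar {poly L}].-nat B.
  have := pchar_nat_exp h; apply: sub_in_pnat => p _.
  by rewrite !inE => /andP[-> /=]; rewrite -polyC_natr polyC_eq0.
have Phi0 : \sum_(u < N) V u ^+ B * H u = 0.
  have : Phi V1 = Phi V2.
    by rewrite -[LHS](poly_rV_K (sPhi V1)) -[RHS](poly_rV_K (sPhi V2)) eV.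
  move/eqP; rewrite -subr_eq0 => /eqP; apply: etrans; rewrite /Phi -sumrB; apply: eq_bigr => u _.
  by rewrite VE -mulrBl exprDn_pchar // exprNn_pchar.
pose P := \sum_(u < N) V u * M u.
have sV u : (size (V u) <= D)%N.
  by rewrite /V; case: insubP => [i _ _|_]; rewrite ?size_poly0 // size_poly.
have P0 : P != 0.
  apply: contraNneq nV => P0; apply/eqP/ffunP => u.
  have := sum_monic_mul_eq0 sV (fun u _ => mM u) (fun u _ => sM u) P0 (ltn_ord u).
  rewrite VE -linearB /= => /(congr1 (@poly_rV _ D)); rewrite rVpolyK linear0.
  by move/eqP; rewrite subr_eq0 => /eqP.
have sP : (size P <= B * D + 4 * B)%N.
  apply: (leq_trans (size_sum _ _ _)); apply/bigmax_leqP => u _.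
  apply: (leq_trans (size_polyMleq _ _)); rewrite sM addnS /=.
  have le1 : (D * (u + q.-1).+1 <= D * (q * (D + 3) + q))%N.
    by rewrite leq_mul2l; apply/orP; right; have := ltn_ord u; rewrite /N /J; lia.
  have := sV u; rewrite BE; move: le1; rewrite mulnS.
  by move: (size (V u)) (D * _)%N => s v; lia.
set X := [set x | _]; rewrite cardE.
apply: (leq_trans _ sP); apply: ltnW; apply: max_poly_roots => //; last exact: enum_uniq.
apply/allP => x; rewrite mem_enum inE => /and3P[x0 /eqP xB /eqP wB].
have B0 : (0 < B)%N by rewrite expn_gt0 q0.
set w := half_trace x in wB.
(* At [x] both [M u] and [H u] carry the factor x^((q-1)D), independently of [u], but that of [M u]
   gets raised to the power [B]. The extra factor here balances the two sides. *)
have key : P.[x] ^+ B * x ^+ (q.-1 * D) = 0.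
  have -> : P.[x] ^+ B = \sum_(u < N) (V u).[x] ^+ B * (M u).[x] ^+ B.
    rewrite horner_sum; elim/big_rec2: _ => [|u y z _ <-].
      by rewrite expr0n eqn0Ngt B0.
    by rewrite exprDn_pchar ?pchar_nat_exp // hornerM exprMn.
  have xq u : x ^+ ((q.-1 - u %% q) * D) * (x ^+ D) ^+ (u %% q) = x ^+ (q.-1 * D).
    by rewrite -exprM -exprD mulnC -mulnDr subnK // mulnC.
  transitivity (x ^+ (q.-1 * D) ^+ B * (\sum_(u < N) V u ^+ B * H u).[x]); last first.
    by rewrite Phi0 horner0 mulr0.
  rewrite horner_sum mulr_suml mulr_sumr; apply: eq_bigr => u _.
  have -> : (M u).[x] = x ^+ (u %/ q * B) * w ^+ (u %% q) * x ^+ (q.-1 * D).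
    by rewrite /M !hornerM !horner_exp !hornerX half_trace_numE // exprMn -(xq u) -/w; ring.
  rewrite [(_ * H u).[x]]hornerM.
  have -> : (H u).[x] = x ^+ (u %/ q) * (c - w) ^+ (u %% q) * x ^+ (q.-1 * D).
    rewrite /H !hornerM !horner_exp !hornerE half_trace_numE // -/w.
    have -> : c * x ^+ D - x ^+ D * w = x ^+ D * (c - w) by ring.
    by rewrite exprMn -(xq u); ring.
  rewrite horner_exp !exprMn -!exprM.
  have -> : x ^+ (u %/ q * B * B) = x ^+ (u %/ q).
    by rewrite -mulnA mulnC exprM xB.
  have -> : w ^+ (u %% q * B) = (c - w) ^+ (u %% q) by rewrite mulnC exprM wB.
  by ring.
rewrite rootE; move/eqP: key; rewrite mulf_eq0 expf_eq0 B0 /=.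
by rewrite [x ^+ _ == 0]expf_eq0 (negbTE x0) andbF orbF.
Qed.

End Stepanov.

(** * Kloosterman sums over a quadratic extension *)

Section FixedField.
Variables (L : finFieldType) (Q : nat).
Hypothesis Q_nat : [pchar L].-nat Q.

(** Subfields are represented as sets of fixed points of a Frobenius power inside one large field,
    so a whole chain of extensions lives in a single type. *)
Definition frob_fixed : {set L} := [set x | x ^+ Q == x].

Local Notation K := frob_fixed.

Lemma frob_fixedP x : reflect (x ^+ Q = x) (x \in K).
Proof. by rewrite inE; apply: eqP. Qed.

Lemma frob_fixed0 : 0 \in K.
Proof. by rewrite inE expr0n; case: Q Q_nat. Qed.

Lemma frob_fixedD : {in K &, forall x y, x + y \in K}.
Proof.
move=> x y /frob_fixedP xK /frob_fixedP yK; apply/frob_fixedP.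
by rewrite exprDn_pchar // xK yK.
Qed.

Lemma frob_fixedN : {in K, forall x, - x \in K}.
Proof. by move=> x /frob_fixedP xK; apply/frob_fixedP; rewrite exprNn_pchar // xK. Qed.

Lemma frob_fixedM : {in K &, forall x y, x * y \in K}.
Proof. by move=> x y /frob_fixedP xK /frob_fixedP yK; apply/frob_fixedP; rewrite exprMn xK yK. Qed.

Lemma frob_fixedV : {in K, forall x, x^-1 \in K}.
Proof. by move=> x /frob_fixedP xK; apply/frob_fixedP; rewrite exprVn xK. Qed.

Lemma frob_fixed_char_sum (psi : L -> algC) b :
  psi 0 = 1 -> {in K &, {morph psi : x y / x + y >-> x * y}} ->
  (exists2 x, x \in K & psi x != 1) -> b \in K ->
  \sum_(s in K) psi (s * b) = if b == 0 then #|K|%:R else 0.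
Proof.
move=> psi0 psiD [x0 x0K psi1] bK; case: eqP => [->|/eqP b0].
  by rewrite -sum1_card natr_sum; apply: eq_bigr => s _; rewrite mulr0 psi0.
set S := LHS; suff e : S = S * psi x0.
  apply/eqP; move/eqP: e; rewrite -subr_eq0 -{1}[S]mulr1 -mulrBr mulf_eq0 => /orP[//|].
  by rewrite subr_eq0 eq_sym (negbTE psi1).
have cK : x0 / b \in K by rewrite frob_fixedM ?frob_fixedV.
rewrite mulr_suml [LHS](reindex_inj (addIr (x0 / b))) /=.
have e s : (s + x0 / b \in K) = (s \in K).
  apply/idP/idP => sK; last exact: frob_fixedD.
  by rewrite -(addrK (x0 / b) s) frob_fixedD ?frob_fixedN.
rewrite (eq_bigl _ _ e); apply: eq_bigr => s sK.
by rewrite mulrDl divfK // psiD // frob_fixedM.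
Qed.

End FixedField.

Definition kloosterman (L : finFieldType) (K : {set L}) (psi : L -> algC) (a : L) : algC :=
  \sum_(x in K | x != 0) psi (x + a / x).

Section QuadraticExtension.
Variables (L : finFieldType) (Q : nat).
Hypothesis Q_nat : [pchar L].-nat Q.
Local Notation K := (frob_fixed L Q).
Local Notation K2 := (frob_fixed L (Q * Q)).
Hypotheses (cardK : #|K| = Q) (cardK2 : #|K2| = (Q * Q)%N).

(** The factorizations of X^2 - sX + n over K, as ordered pairs of roots. *)
Definition base_fiber (s n : L) : {set L * L} :=
  [set u in setX K K | (u.1 + u.2 == s) && (u.1 * u.2 == n)].

Definition ext_fiber (s n : L) : {set L} :=
  [set z in K2 | (z + z ^+ Q == s) && (z * z ^+ Q == n)].

(** Two distinct roots in K give two ordered pairs and no [z]. A double root gives one pair and one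
    [z], which then lies in K. Without roots in K there are only [z] and its conjugate. *)
Lemma quadratic_fiber_le2 (s n : L) :
  (#|base_fiber s n| + #|ext_fiber s n| <= 2)%N.
Proof.
set A := base_fiber s n; set C := ext_fiber s n.
have root2 (z w x : L) : z + w = s -> z * w = n -> x ^+ 2 - s * x + n = 0 -> (x == z) || (x == w).
  move=> <- <- e; rewrite -(subr_eq0 x) -(subr_eq0 x) -mulf_eq0.
  by apply/eqP; rewrite -e; ring.
have [-> | [[u v]]] := set_0Vmem A.
  rewrite cards0 add0n; have [-> | [z zC]] := set_0Vmem C; first by rewrite cards0.
  move: (zC); rewrite inE => /and3P[_ /eqP zs /eqP zn].
  apply: (@leq_trans #|[set z; z ^+ Q]|); last by rewrite cards2; case: (_ != _).
  apply/subset_leq_card/subsetP => x; rewrite !inE => /and3P[_ /eqP xs /eqP xn].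
  by apply: (root2 _ _ _ zs zn); rewrite -xs -xn; ring.
rewrite inE /= in_setX /= => /andP[/andP[uK vK] /andP[/eqP us /eqP un]].
have subA : A \subset [set (u, v); (v, u)].
  apply/subsetP => -[x y]; rewrite !inE /= => /andP[_ /andP[/eqP xs /eqP xn]].
  have /orP[/eqP xu|/eqP xv] : (x == u) || (x == v).
  - by apply: (root2 _ _ _ us un); rewrite -xs -xn; ring.
  - have -> : y = v by apply: (addrI u); rewrite us -xs xu.
    by rewrite xu eqxx.
  - have -> : y = u by apply: (addrI v); rewrite (addrC v u) us -xs xv.
    by rewrite xv eqxx orbT.
have [-> | [z]] := set_0Vmem C.
  rewrite cards0 addn0; apply: (leq_trans (subset_leq_card subA)).
  by rewrite cards2; case: (_ != _).
rewrite inE => /and3P[_ /eqP zs /eqP zn].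
have zK : z ^+ Q = z.
  apply/frob_fixedP.
  have /orP[/eqP->//|/eqP->//] : (z == u) || (z == v).
  by apply: (root2 _ _ _ us un); rewrite -zs -zn; ring.
have eqz (x w : L) : x + w = s -> x * w = n -> x = z /\ w = z.
  move=> xs xn; have : (x - z) ^+ 2 = 0.
    have : x ^+ 2 - s * x + n = 0 by rewrite -xs -xn; ring.
    by rewrite -zs -zn zK => <-; ring.
  move/eqP; rewrite expf_eq0 /= subr_eq0 => /eqP xz; split=> //.
  by apply: (addrI x); rewrite xs -zs zK xz.
have -> : A = [set (z, z)].
  apply/eqP; rewrite eqEsubset; apply/andP; split; last first.
    rewrite sub1set inE in_setX /= !inE zK eqxx /=.
    by move: zs zn; rewrite zK => -> ->; rewrite !eqxx.
  apply/subsetP => -[x y]; rewrite !inE /= => /andP[_ /andP[/eqP xs /eqP xn]].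
  by have [-> ->] := eqz _ _ xs xn.
have : C \subset [set z].
  apply/subsetP => x; rewrite !inE => /and3P[_ /eqP xs /eqP xn].
  by have [-> _] := eqz _ _ xs xn.
by move/subset_leq_card; rewrite !cards1.
Qed.

Lemma trace_in_base z : z \in K2 -> z + z ^+ Q \in K.
Proof.
move/frob_fixedP => zK; apply/frob_fixedP.
by rewrite exprDn_pchar // -exprM zK addrC.
Qed.

Lemma norm_in_base z : z \in K2 -> z * z ^+ Q \in K.
Proof.
by move/frob_fixedP => zK; apply/frob_fixedP; rewrite exprMn -exprM zK mulrC.
Qed.

(* X^2 - sX + n splits either over K or over the quadratic extension, in which case its roots
   are conjugate.  Existence of the roots comes for free: both families of fibers are
   partitions of sets of cardinality Q^2, and each of the Q^2 totals is at most 2. *)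
Lemma quadratic_fiber (s n : L) : s \in K -> n \in K ->
  (#|base_fiber s n| + #|ext_fiber s n| = 2)%N.
Proof.
move=> sK nK.
pose c s n := (#|base_fiber s n| + #|ext_fiber s n|)%N; rewrite -/(c s n).
have tot : (\sum_(p in setX K K) c p.1 p.2 = \sum_(p in setX K K) 2)%N.
  rewrite sum_nat_const cardsX cardK big_split /=.
  have -> : (\sum_(p in setX K K) #|base_fiber p.1 p.2|
            = #|setX K K|)%N.
    transitivity (\sum_(u in setX K K) 1)%N; last by rewrite sum1_card.
    rewrite [RHS](partition_big (fun u => (u.1 + u.2, u.1 * u.2)) (mem (setX K K))) /=.
      apply: eq_bigr => p _; rewrite -sum1_card; apply: eq_bigl => u.
      by rewrite [LHS]inE -xpair_eqE -surjective_pairing.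
    by case=> u v; rewrite !in_setX /= => /andP[uK vK]; rewrite frob_fixedD ?frob_fixedM.
  have -> : (\sum_(p in setX K K) #|ext_fiber p.1 p.2|
            = #|K2|)%N.
    transitivity (\sum_(u in K2) 1)%N; last by rewrite sum1_card.
    rewrite [RHS](partition_big (fun z => (z + z ^+ Q, z * z ^+ Q)) (mem (setX K K))) /=.
      apply: eq_bigr => p _; rewrite -sum1_card; apply: eq_bigl => u.
      by rewrite [LHS]inE -xpair_eqE -surjective_pairing.
    by move=> u uK; rewrite in_setX /= trace_in_base ?norm_in_base.
  by rewrite cardsX cardK cardK2 muln2 addnn.
have le p : p \in setX K K -> (c p.1 p.2 <= 2)%N by move=> _; exact: quadratic_fiber_le2.
have [_] := leqif_sum (fun p pK => leqif_eq (le p pK)).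
rewrite tot eqxx => /esym/forall_inP/(_ (s, n)).
by rewrite in_setX sK nK => /(_ isT)/eqP.
Qed.

(* Both sums are sums of psi (s (1 + a/n)) over pairs (s, n), so by [quadratic_fiber] they add
   up to twice the full sum, in which only n = - a survives. *)
Lemma kloosterman_quadratic (psi : L -> algC) (a : L) :
  psi 0 = 1 -> {in K &, {morph psi : x y / x + y >-> x * y}} ->
  (exists2 x, x \in K & psi x != 1) -> a \in K -> a != 0 ->
  kloosterman K2 (fun z => psi (z + z ^+ Q)) a = Q%:R *+ 2 - kloosterman K psi a ^+ 2.
Proof.
move=> psi0 psiD psi1 aK a0.
pose g (p : L * L) := psi (p.1 * (1 + a / p.2)).
pose R : pred (L * L) := fun p => (p \in setX K K) && (p.2 != 0).
have sumK (T : finType) (D : {set T}) (f : T -> L * L) :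
    {in D, forall u, f u \in setX K K} ->
    \sum_(u in D | (f u).2 != 0) g (f u)
      = \sum_(p | R p) g p *+ #|[set u in D | ((f u).1 == p.1) && ((f u).2 == p.2)]|.
  move=> fK; rewrite (partition_big f R) /=; last first.
    by move=> u /andP[uD u0]; rewrite /R fK.
  apply: eq_bigr => p /andP[_ p0]; rewrite -sumr_const; apply: eq_big => u.
    rewrite inE -andbA; case: (u \in D) => //=.
    have -> : (f u == p) = ((f u).1 == p.1) && ((f u).2 == p.2).
      by rewrite -xpair_eqE -!surjective_pairing.
    by case: ((f u).2 =P p.2) => [->|_]; rewrite ?p0 ?andbF.
  by move=> /andP[_ /eqP->].
(* Since x + a/x + y + a/y = (x + y)(1 + a/(xy)), the product of two terms depends only on the sum
   and the product of x and y. *)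
have gE (x y : L) : x != 0 -> y != 0 -> g (x + y, x * y) = psi (x + a / x + (y + a / y)).
  by move=> x0 y0; rewrite /g /=; congr psi; field; rewrite x0 y0.
have e1 : kloosterman K psi a ^+ 2 =
    \sum_(u in setX K K | u.1 * u.2 != 0) g (u.1 + u.2, u.1 * u.2).
  rewrite expr2 /kloosterman big_distrlr pair_big_dep /=; apply: eq_big => u.
    by case: u => u v; rewrite in_setX mulf_eq0 negb_or andbACA.
  move=> /andP[/andP[uK u0] /andP[vK v0]].
  have xaK x : x \in K -> x + a / x \in K.
    by move=> xK; rewrite frob_fixedD // frob_fixedM // frob_fixedV.
  by rewrite gE // [RHS]psiD ?xaK.
have e2 : kloosterman K2 (fun z => psi (z + z ^+ Q)) a =
    \sum_(z in K2 | z * z ^+ Q != 0) g (z + z ^+ Q, z * z ^+ Q).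
  apply: eq_big => z.
    by rewrite mulf_eq0 expf_eq0; congr (_ && ~~ _); case: (z == 0); rewrite ?andbF.
  move=> /andP[zK z0]; rewrite gE ?expf_neq0 //; congr psi.
  rewrite exprDn_pchar // expr_div_n; move/frob_fixedP: aK => ->; ring.
have -> : Q%:R *+ 2 = \sum_(p | R p) g p *+ 2.
  rewrite sumrMnl; congr (_ *+ 2); apply: esym.
  rewrite (eq_bigl (fun p : L * L => (p.1 \in K) && ((p.2 \in K) && (p.2 != 0)))); last first.
    by case=> s n; rewrite /R in_setX andbA.
  rewrite -(pair_big (mem K) (fun n => (n \in K) && (n != 0)) (fun s n => psi (s * (1 + a / n)))).
  rewrite exchange_big /= (bigD1 (- a)) /=; last by rewrite frob_fixedN // oppr_eq0.
  rewrite frob_fixed_char_sum // ?invrN ?mulrN ?divff ?subrr ?frob_fixed0 // eqxx cardK.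
  rewrite big1 ?addr0 // => n /andP[/andP[nK n0] na].
  rewrite frob_fixed_char_sum // ?frob_fixedD ?frob_fixedM ?frob_fixedV //; last first.
    by rewrite inE expr1n.
  case: eqP => // /(congr1 (fun x => x * n)); rewrite mul0r mulrDl divfK // mul1r => /eqP.
  by rewrite addr_eq0 (negbTE na).
apply: (canRL (addrK _)).
rewrite e1 e2 (sumK _ (setX K K) (fun u => (u.1 + u.2, u.1 * u.2))) //; last first.
  by case=> u v; rewrite !in_setX /= => /andP[uK vK]; rewrite frob_fixedD ?frob_fixedM.
rewrite (sumK _ K2 (fun z => (z + z ^+ Q, z * z ^+ Q))) //; last first.
  by move=> u uK; rewrite in_setX /= trace_in_base ?norm_in_base.
rewrite -big_split /=; apply: eq_bigr => -[s n] /andP[]; rewrite in_setX => /andP[sK nK] _.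
by rewrite -mulrnDr addnC quadratic_fiber.
Qed.
End QuadraticExtension.

(** * The bound on Kloosterman sums *)

Lemma dvdp_frobenius (R : fieldType) (Q n : nat) :
  [pchar R].-nat Q -> ('X^Q - 'X : {poly R}) %| 'X^(Q ^ n) - 'X.
Proof.
move=> Q_nat; have pQ : [pchar {poly R}].-nat Q.
  apply: sub_in_pnat Q_nat => p _.
  by rewrite !inE => /andP[-> /=]; rewrite -polyC_natr polyC_eq0.
elim: n => [|n IH]; first by rewrite expn0 expr1 subrr dvdp0.
have -> : 'X^(Q ^ n.+1) - 'X = ('X^(Q ^ n) - 'X) ^+ Q + ('X^Q - 'X) :> {poly R}.
  by rewrite exprDn_pchar // exprNn_pchar // -exprM -expnSr addrA subrK.
rewrite dvdp_addl //; apply: (dvdp_trans IH).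
by case: Q Q_nat {IH pQ} => // Q _; rewrite exprS dvdp_mulr.
Qed.

(** ['X^Q - 'X] divides a split polynomial, hence splits, and its derivative is -1, so its [Q] roots
    are distinct. *)
Lemma card_frob_fixed (L : finFieldType) (Q n : nat) (rs : seq L) :
  [pchar L].-nat Q -> (1 < Q)%N -> 'X^(Q ^ n) - 'X %= \prod_(z <- rs) ('X - z%:P) ->
  #|frob_fixed L Q| = Q.
Proof.
move=> Q_nat Q1 eP; have := dvdp_frobenius n Q_nat.
rewrite (eqp_dvdr _ eP) => /dvdp_prod_XsubC[m eQ].
set s := mask m rs in eQ.
have sQ : size ('X^Q - 'X : {poly L}) = Q.+1.
  by rewrite size_polyDl size_polyXn // size_polyN size_polyX.
have us : uniq s.
  rewrite -separable_prod_XsubC -(eqp_separable eQ) unlock.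
  rewrite derivB derivXn derivX.
  have Q0 : Q%:R = 0 :> L.
    have [p p_pr pL] := finPcharP L.
    have := Q_nat; rewrite (eq_pnat _ (pcharf_eq pL)) => /p_natP[e eE].
    have e0 : e != 0%N by case: e eE Q1 => // ->.
    by rewrite eE natrX (pcharf0 pL) expr0n (negbTE e0).
  rewrite -[X in X - 1]mulr_natl -polyC_natr Q0 mul0r sub0r.
  by rewrite -(@coprimepZr _ (-1)) ?oppr_eq0 ?oner_eq0 // scaleN1r opprK coprimep1.
have sz : size s = Q.
  by apply/eqP; rewrite -eqSS -sQ (eqp_size eQ) size_prod_XsubC.
rewrite -[RHS]sz -(card_uniqP us); apply: eq_card => x.
rewrite inE -root_prod_XsubC -(eqp_root eQ) rootE !hornerE.
by rewrite subr_eq0.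
Qed.

Lemma splitting_extension (F : finFieldType) (n : nat) :
  (0 < n)%N -> exists (L : finFieldType) (iota : {rmorphism F -> L}) (rs : seq L),
    'X^(#|F| ^ n) - 'X %= \prod_(z <- rs) ('X - z%:P).
Proof.
move=> n0; set Q := (#|F| ^ n)%N.
have Q1 : (1 < Q)%N.
  apply: (leq_trans (finNzRing_gt1 F)).
  by rewrite /Q -{1}(expn1 #|F|) leq_exp2l // finNzRing_gt1.
have P0 : 'X^Q - 'X != 0 :> {poly F}.
  by rewrite -size_poly_eq0 size_polyDl size_polyXn // size_polyN size_polyX.
have [L [rs eP _]] := FinSplittingFieldFor P0.
exists (FinFieldExtType L), (in_alg L), rs.
by move: eP; rewrite rmorphB /= map_polyXn map_polyX.
Qed.

Lemma sum_ord_double (V : nmodType) n (f : nat -> V) :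
  \sum_(j < n + n) f j = \sum_(j < n) (f j + f (n + j)%N).
Proof. by rewrite big_split_ord big_split. Qed.

Section AdditiveCharacter.
Variables (F : finFieldType) (chi : F -> algC).
Hypotheses (chiD : {morph chi : x y / x + y >-> x * y})
  (chi_norm : forall x, `|chi x| = 1) (chi_nt : exists x, chi x != 1).

Lemma add_char0 : chi 0 = 1.
Proof.
have c0 : chi 0 != 0 by rewrite -normr_eq0 chi_norm oner_eq0.
by apply: (mulfI c0); rewrite -chiD addr0 mulr1.
Qed.

Lemma add_charN x : chi (- x) = (chi x)^*.
Proof.
have c0 : chi x != 0 by rewrite -normr_eq0 chi_norm oner_eq0.
apply: (mulfI c0); rewrite -chiD subrr add_char0 -normCK chi_norm expr1n //.
Qed.

Lemma add_char_sum b : \sum_x chi (x * b) = if b == 0 then #|F|%:R else 0.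
Proof.
case: eqP => [->|/eqP b0].
  by rewrite -sum1_card natr_sum; apply: eq_bigr => s _; rewrite mulr0 add_char0.
have [x0 nx] := chi_nt; set S := LHS; suff e : S = S * chi x0.
  apply/eqP; move/eqP: e; rewrite -subr_eq0 -{1}[S]mulr1 -mulrBr mulf_eq0 => /orP[//|].
  by rewrite subr_eq0 eq_sym (negbTE nx).
rewrite mulr_suml [LHS](reindex_inj (addIr (x0 / b))) /=; apply: eq_bigr => x _.
by rewrite mulrDl divfK // chiD.
Qed.

End AdditiveCharacter.

Section Tower.
Variables (F L : finFieldType) (iota : {rmorphism F -> L}) (h : nat) (rs : seq L).
Variables (chi : F -> algC) (a : F).
Local Notation q := #|F|.
Hypotheses (splitL : 'X^(q ^ (2 ^ h)) - 'X %= \prod_(z <- rs) ('X - z%:P)).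
Hypotheses (chiD : {morph chi : x y / x + y >-> x * y})
  (chi_norm : forall x, `|chi x| = 1) (chi_nt : exists x, chi x != 1).
Hypotheses (two0 : 2%:R != 0 :> F) (a0 : a != 0).

(** For [i <= h], [K i] is the subfield of order [Q i], and each is quadratic over the one
    before. *)
Local Notation Q i := (q ^ (2 ^ i))%N.
Local Notation K i := (frob_fixed L (Q i)).

Lemma field_card_gt1 : (1 < q)%N. Proof. exact: finNzRing_gt1. Qed.

Lemma tower_card_gt1 i : (1 < Q i)%N.
Proof.
by apply: (leq_trans field_card_gt1); rewrite -{1}(expn1 q) leq_exp2l ?field_card_gt1 // expn_gt0.
Qed.

Lemma field_card_pnat : [pchar L].-nat q.
Proof.
have [p p_pr pF] := finPcharP F.
rewrite (card_pprimeChar pF) (eq_pnat _ (pcharf_eq (rmorph_pchar iota pF))).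
by rewrite pnatX pnat_id ?orbT.
Qed.

Lemma tower_card_pnat i : [pchar L].-nat (Q i).
Proof. by rewrite pnatX field_card_pnat. Qed.

Lemma tower_cardS i : Q i.+1 = (Q i * Q i)%N.
Proof. by rewrite expnS mul2n -addnn expnD. Qed.

Lemma card_tower_field i : (i <= h)%N -> #|K i| = Q i.
Proof.
move=> ih; apply: (@card_frob_fixed L (Q i) (2 ^ (h - i)) rs) => //.
- exact: tower_card_pnat.
- exact: tower_card_gt1.
- by rewrite -expnM -expnD subnKC.
Qed.

Lemma tower_field_iota i c : iota c \in K i.
Proof.
rewrite inE -rmorphXn; apply/eqP; congr (iota _).
by elim: (2 ^ i)%N => [|n IH]; rewrite ?expn0 ?expr1 // expnS exprM expf_card.
Qed.

Lemma tower_field0P x : reflect (exists c, x = iota c) (x \in K 0).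
Proof.
suff -> : K 0 = iota @: F.
  by apply: (iffP imsetP) => [[c _ ->]|[c ->]]; exists c.
apply/esym/eqP; rewrite eqEcard card_tower_field // card_imset ?leqnn; last exact: fmorph_inj.
by rewrite andbT; apply/subsetP => _ /imsetP[c _ ->]; exact: tower_field_iota.
Qed.

(* Junk value 0 outside the image of iota. *)
Definition base_char (x : L) : algC :=
  if [pick c | iota c == x] is Some c then chi c else 0.

Lemma base_charE c : base_char (iota c) = chi c.
Proof.
rewrite /base_char; case: pickP => [c' /eqP/fmorph_inj->//|/(_ c)].
by rewrite eqxx.
Qed.

(* The character chi o Tr of the i-th field of the tower, the trace being taken one quadratic
   step at a time. *)
Fixpoint tower_char (i : nat) : L -> algC :=
  if i is i'.+1 then fun z => tower_char i' (z + z ^+ Q i') else base_char.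

Lemma tower_char0 i : tower_char i 0 = 1.
Proof.
elim: i => [|i IH] /=; first by rewrite -(rmorph0 iota) base_charE add_char0.
by rewrite expr0n expn_eq0 (gtn_eqF (ltnW field_card_gt1)) addr0.
Qed.

Lemma tower_charD i : (i <= h)%N ->
  {in K i &, {morph tower_char i : x y / x + y >-> x * y}}.
Proof.
elim: i => [|i IH] ih x y /=.
  by move=> /tower_field0P[c ->] /tower_field0P[c' ->]; rewrite -rmorphD !base_charE chiD.
rewrite tower_cardS => xK yK; rewrite exprDn_pchar ?tower_card_pnat // addrACA.
by rewrite [LHS](IH (ltnW ih)) ?trace_in_base ?tower_card_pnat.
Qed.

Lemma tower_field_sub i : K i \subset K i.+1.
Proof.
by apply/subsetP => x /frob_fixedP xK; apply/frob_fixedP; rewrite tower_cardS exprM xK.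
Qed.

(** In odd characteristic x/2 has trace x in a quadratic step, so a nontrivial value lifts from each
    field to the next. *)
Lemma tower_char_nt i : exists2 x, x \in K i & tower_char i x != 1.
Proof.
elim: i => [|i [x xK nx]].
  by have [c nc] := chi_nt; exists (iota c); rewrite ?tower_field_iota //= base_charE.
have t0 : 2%:R != 0 :> L by rewrite -(rmorph_nat iota) fmorph_eq0.
have tK : 2%:R \in K i by rewrite -(rmorph_nat iota) tower_field_iota.
have xK2 : x / 2%:R \in K i by rewrite frob_fixedM ?frob_fixedV ?tower_card_pnat.
exists (x / 2%:R); first exact: (subsetP (tower_field_sub i)).
move/frob_fixedP: (xK2) => /= ->.
by have -> : x / 2%:R + x / 2%:R = x by field.
Qed.

Definition tower_sum i := kloosterman (K i) (tower_char i) (iota a).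

Lemma tower_sumS i : (i < h)%N -> tower_sum i.+1 = (Q i)%:R *+ 2 - tower_sum i ^+ 2.
Proof.
move=> ih; rewrite /tower_sum tower_cardS.
apply: kloosterman_quadratic.
- exact: tower_card_pnat.
- by rewrite card_tower_field // ltnW.
- by rewrite -tower_cardS card_tower_field.
- exact: tower_char0.
- by apply: tower_charD; exact: ltnW.
- exact: tower_char_nt.
- exact: tower_field_iota.
- by rewrite fmorph_eq0.
Qed.

Lemma tower_sum0 : tower_sum 0 = kloosterman [set: F] chi a.
Proof.
rewrite /tower_sum /kloosterman.
have -> : K 0 = iota @: [set: F].
  apply/setP => x; apply/idP/imsetP => [/tower_field0P[c ->]|[c _ ->]]; first by exists c.
  exact: tower_field_iota.
rewrite big_imset_cond /=; last by move=> x y _ _; exact: fmorph_inj.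
apply: eq_big => c; first by rewrite fmorph_eq0.
by move=> _; rewrite -fmorphV -rmorphM -rmorphD base_charE.
Qed.

Lemma tower_char_trace i z : tower_char i z = base_char (\sum_(j < 2 ^ i) z ^+ (q ^ j)).
Proof.
elim: i z => [|i IH] z /=; first by rewrite big_ord1 expr1.
rewrite IH; congr base_char.
have -> : (2 ^ i.+1 = 2 ^ i + 2 ^ i)%N by rewrite expnS mul2n addnn.
rewrite (sum_ord_double _ (fun j => z ^+ (q ^ j))); apply: eq_bigr => j _.
by rewrite exprDn_pchar ?pnatX ?field_card_pnat // -exprM -expnD addnC.
Qed.

(** Stepanov's method bounds each class [A c] of prescribed trace from above only, by [T]. As the
    values of [chi] sum to 0, [#|A c|] may be replaced by [T - #|A c|] up to sign. These weights are
    nonnegative with total q T - (B^2 - 1) = 4 q B + 1, because q D = B. *)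
Lemma tower_sum_bound : (0 < h)%N -> `|tower_sum h| <= (5 * q * q ^ (2 ^ h.-1))%:R.
Proof.
move=> h0; set n := (2 ^ h.-1)%N; set B := (q ^ n)%N; set D := (q ^ n.-1)%N.
have n0 : (0 < n)%N by rewrite expn_gt0.
have e2 : (2 ^ h = n + n)%N by rewrite addnn -mul2n -expnS prednK.
have BB : (Q h = B * B)%N by rewrite e2 expnD.
pose f (x : L) : L := x + iota a / x.
pose Tr (z : L) : L := \sum_(j < 2 ^ h) z ^+ (q ^ j).
pose A (c : F) : {set L} := [set x in K h | (x != 0) && (Tr (f x) == iota c)].
have cA c : (#|A c| <= B * D + 4 * B)%N.
  apply: leq_trans (stepanov_bound (iota a) (iota c) field_card_gt1 n0 field_card_pnat).
  apply/subset_leq_card/subsetP => x; rewrite !inE => /and3P[/eqP xK x0 /eqP xT].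
  rewrite x0 -BB xK eqxx /= eq_sym subr_eq -xT /Tr; apply/eqP.
  rewrite e2 (sum_ord_double _ (fun j => f x ^+ (q ^ j))) big_split /= addrC.
  congr (_ + _); rewrite /half_trace.
  rewrite (big_morph (fun z => z ^+ B) (id1 := 0) (op1 := +%R)).
  - by apply: eq_bigr => j _; rewrite -exprM -expnD addnC.
  - by move=> x1 y1; rewrite exprDn_pchar // pnatX field_card_pnat.
  - by rewrite expr0n expn_eq0 (gtn_eqF (ltnW field_card_gt1)).
have fK x : x \in K h -> f x \in K h.
  by move=> xK; rewrite /f frob_fixedD ?frob_fixedM ?frob_fixedV ?tower_field_iota ?tower_card_pnat.
have TrK x : x \in K h -> exists c, Tr x = iota c.
  move=> /frob_fixedP xK; apply/tower_field0P; rewrite inE expn1; apply/eqP.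
  rewrite /Tr (big_morph (fun z => z ^+ q) (id1 := 0) (op1 := +%R)); last first.
  - by rewrite expr0n (gtn_eqF (ltnW field_card_gt1)).
  - by move=> x1 y1; rewrite exprDn_pchar // field_card_pnat.
  under eq_bigr do rewrite -exprM -expnSr.
  move: (2 ^ h)%N xK => [|N] xK; first by rewrite !big_ord0.
  by rewrite big_ord_recr big_ord_recl /= xK addrC expr1.
have sumE (g : F -> algC) : \sum_(x in K h | x != 0) (\sum_(c | Tr (f x) == iota c) g c)
      = \sum_c g c *+ #|A c|.
  rewrite (exchange_big_dep xpredT) //=; apply: eq_bigr => c _.
  by rewrite -sumr_const; apply: eq_bigl => x; rewrite [RHS]inE andbA.
have pick1 x (g : F -> algC) : x \in K h -> exists2 c0, Tr (f x) = iota c0 &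
   \sum_(c | Tr (f x) == iota c) g c = g c0.
  move=> xK; have [c0 e] := TrK _ (fK _ xK); exists c0 => //.
  rewrite (big_pred1 c0) // => c; rewrite e eq_sym; apply/eqP/eqP => [/fmorph_inj//|->//].
have -> : tower_sum h = \sum_c chi c *+ #|A c|.
  rewrite -sumE; apply: eq_bigr => x /andP[xK _].
  have [c0 e ->] := pick1 x chi xK.
  by rewrite tower_char_trace -/(Tr _) e base_charE.
have cardA : (\sum_c #|A c| = (Q h).-1)%N.
  apply/eqP; rewrite -(eqr_nat algC) natr_sum.
  rewrite (eq_bigr (fun c => 1 *+ #|A c|)) // -sumE.
  rewrite (eq_bigr (fun=> 1)); last by move=> x /andP[xK _]; have [] := pick1 x (fun=> 1) xK.
  rewrite sumr_const eqr_nat; apply/eqP.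
  have := cardD1 0 (K h); rewrite frob_fixed0 ?tower_card_pnat // card_tower_field // add1n => e.
  apply: succn_inj; rewrite prednK ?(ltnW (tower_card_gt1 h)) // [RHS]e; congr _.+1.
  by apply: eq_card => x; rewrite [RHS]inE andbC.
set T := (B * D + 4 * B)%N.
have -> : \sum_c chi c *+ #|A c| = - \sum_c chi c *+ (T - #|A c|).
  apply/eqP; rewrite -addr_eq0 -big_split /=.
  rewrite (eq_bigr (fun c => chi (c * 1) *+ T)) => [|c _]; last first.
    by rewrite -mulrnDr subnKC ?cA // mulr1.
  by rewrite sumrMnl add_char_sum // oner_eq0 mul0rn.
rewrite normrN; apply: (le_trans (ler_norm_sum _ _ _)).
rewrite (eq_bigr (fun c => (T - #|A c|)%:R)) => [|c _]; last first.
  by rewrite normrMn chi_norm.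
rewrite -natr_sum ler_nat.
have : (\sum_c (T - #|A c|) + \sum_c #|A c| = q * T)%N.
  rewrite -big_split /= (eq_bigr (fun=> T)) => [|c _]; last by rewrite subnK ?cA.
  by rewrite sum_nat_const.
have BD : (B = q * D)%N by rewrite /B -{1}(prednK n0) expnS.
have := field_card_gt1; have : (0 < B)%N by rewrite expn_gt0 ltnW ?field_card_gt1.
rewrite cardA /T mulnDr mulnCA -BD BB.
move: (\sum_c _)%N => s; move: q => q'; nia.
Qed.

End Tower.

Section KloostermanBound.
Variables (F : finFieldType) (chi : F -> algC).
Local Notation q := #|F|.
Hypotheses (chiD : {morph chi : x y / x + y >-> x * y})
  (chi_norm : forall x, `|chi x| = 1) (chi_nt : exists x, chi x != 1).
Hypotheses (two0 : 2%:R != 0 :> F).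

Lemma kloosterman_real a : kloosterman [set: F] chi a \is Num.real.
Proof.
apply/CrealP; rewrite /kloosterman rmorph_sum /= (reindex_inj oppr_inj) /=.
apply: eq_big => x; first by rewrite !in_setT oppr_eq0.
by move=> _; rewrite -add_charN // invrN mulrN opprD !opprK.
Qed.

(* Along the tower k_(i+1) = 2 Q_i - k_i^2, so k_(i+1)^2 - 4 Q_(i+1) = k_i^2 (k_i^2 - 4 Q_i):
   if k_0^2 > 4q then (k_i^2 - 4 Q_i) / Q_i grows at least like 4^i, while Stepanov's bound
   keeps it below 25 q^2. *)
Lemma kloosterman_bound a : a != 0 -> kloosterman [set: F] chi a ^+ 2 <= 4%:R * q%:R.
Proof.
move=> a0; set k0 := kloosterman _ _ _.
have k0R : k0 \is Num.real by exact: kloosterman_real.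
have q0 : 0 < q%:R :> algC by rewrite ltr0n (ltnW (finNzRing_gt1 F)).
rewrite real_leNgt ?rpredX ?rpredM ?realn //; apply/negP => big.
pose delta := k0 ^+ 2 - 4%:R * q%:R.
have d0 : 0 < delta by rewrite subr_gt0.
(* Growth along the tower and Stepanov's bound together give 4^h <= 25 q^3 / delta, so any larger
   [h] is contradictory. *)
pose c := 25%:R * q%:R ^+ 3 / delta.
have c0 : 0 <= c by apply: divr_ge0; [rewrite mulr_ge0 ?ler0n ?exprn_ge0 ?ler0n | exact: ltW].
pose h := (Num.bound c).+1.
have ch : c < h%:R.
  by apply: (lt_trans (archi_boundP c0)); rewrite ltr_nat.
have [L [iota [rs splitL]]] : exists (L : finFieldType) (iota : {rmorphism F -> L}) (rs : seq L),
    'X^(q ^ (2 ^ h)) - 'X %= \prod_(z <- rs) ('X - z%:P).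
  by apply: splitting_extension; rewrite expn_gt0.
pose K i := tower_sum iota chi a i.
have K0 : K 0%N = k0 by exact: (tower_sum0 iota chi a splitL).
have KS i : (i < h)%N -> K i.+1 = (q ^ (2 ^ i))%:R *+ 2 - K i ^+ 2.
  by move=> ih; exact: (tower_sumS iota splitL).
have KR i : (i <= h)%N -> K i \is Num.real.
  elim: i => [|i IH] ih; first by rewrite K0.
  rewrite KS //; apply: rpredB; first by rewrite rpredMn ?realn.
  by apply: rpredX; apply: IH; exact: ltnW.
have grow i : (i <= h)%N -> 
    4%:R ^+ i * (q ^ (2 ^ i))%:R * delta <= q%:R * (K i ^+ 2 - 4%:R * (q ^ (2 ^ i))%:R).
  elim: i => [|i IH] ih; first by rewrite expr0 mul1r K0 expn1.
  have := IH (ltnW ih); rewrite KS // expnS mul2n -addnn expnD natrM.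
  set Q := (q ^ (2 ^ i))%:R; set k := K i => le1.
  have Q0 : 0 < Q by rewrite ltr0n expn_gt0 (ltnW (finNzRing_gt1 F)).
  have kR : k \is Num.real by rewrite KR // ltnW.
  have X0 : 0 <= 4%:R ^+ i * Q * delta.
    by rewrite !mulr_ge0 ?exprn_ge0 ?ler0n // ltW.
  have e : q%:R * ((Q *+ 2 - k ^+ 2) ^+ 2 - 4%:R * (Q * Q)) = k ^+ 2 * (q%:R * (k ^+ 2 - 4%:R * Q)).
    by ring.
  rewrite e; have k4 : 4%:R * Q <= k ^+ 2.
    rewrite -subr_ge0 -(pmulr_rge0 _ q0); exact: le_trans X0 le1.
  rewrite exprS.
  have -> : 4%:R * 4%:R ^+ i * (Q * Q) * delta = (4%:R * Q) * (4%:R ^+ i * Q * delta) by ring.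
  by apply: ler_pM => //; rewrite mulr_ge0 ?ler0n // ltW.
have := tower_sum_bound iota splitL chiD chi_norm chi_nt two0 a0 (ltn0Sn _).
rewrite -/(K h) => bnd.
have bnd2 : K h ^+ 2 <= 25%:R * q%:R ^+ 2 * (q ^ (2 ^ h))%:R.
  rewrite -real_normK ?KR //.
  apply: (le_trans (ler_pM (normr_ge0 _) (normr_ge0 _) bnd bnd)).
  rewrite [(2 ^ h)%N]expnS mul2n -addnn expnD !natrM [h.-1]/=.
  by rewrite le_eqVlt; apply/orP; left; apply/eqP; ring.
have := grow h (leqnn h); set Q := (q ^ (2 ^ h))%:R in bnd2 *.
have Q0 : 0 < Q by rewrite ltr0n expn_gt0 (ltnW (finNzRing_gt1 F)).
have : q%:R * (K h ^+ 2 - 4%:R * Q) < 4%:R ^+ h * Q * delta; last first.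
  by move=> /lt_le_trans /[apply]; rewrite ltxx.
apply: (@le_lt_trans _ _ (q%:R * (25%:R * q%:R ^+ 2 * Q))).
  rewrite ler_pM2l //; apply: le_trans bnd2.
  by rewrite gerBl mulr_ge0 ?ler0n // ltW.
have -> : q%:R * (25%:R * q%:R ^+ 2 * Q) = c * delta * Q.
  by rewrite /c divfK ?gt_eqF //; ring.
rewrite [X in _ < X]mulrAC ltr_pM2r // ltr_pM2r //.
apply: (lt_trans ch); rewrite -natrX ltr_nat.
by rewrite ltn_expl.
Qed.

End KloostermanBound.

(** * The quadratic character and Salie sums *)

Section QuadraticCharacter.
Variable F : finFieldType.
Local Notation q := #|F|.
Hypotheses (two0 : 2%:R != 0 :> F) (q_odd : odd q).

Definition quad_char (x : F) : algC :=
  if x == 0 then 0 else if x ^+ q.-1./2 == 1 then 1 else -1.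

Local Notation eta := quad_char.

Lemma euler_sq (x : F) : x != 0 -> (x ^+ q.-1./2) ^+ 2 = 1.
Proof.
move=> x0; rewrite -exprM muln2 halfK.
have q0 : (0 < q)%N by apply: ltnW; exact: finNzRing_gt1.
have -> : odd q.-1 = false by move: q_odd; rewrite -{1}(prednK q0) /= => /negbTE.
rewrite subn0; apply: (mulfI x0); rewrite mulr1 -exprS prednK //; exact: expf_card.
Qed.

Lemma euler_pm1 (x : F) : x != 0 -> x ^+ q.-1./2 = 1 \/ x ^+ q.-1./2 = -1.
Proof. by move/euler_sq/eqP; rewrite sqrf_eq1 => /orP[]/eqP; [left|right]. Qed.

Lemma one_neqN1 : (1 == -1 :> F) = false.
Proof. by apply/negbTE; rewrite -subr_eq0 opprK -[1 + 1]/(2%:R). Qed.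

Lemma quad_charM x y : eta (x * y) = eta x * eta y.
Proof.
rewrite /eta mulf_eq0; have [->|x0] /= := eqVneq x 0; first by rewrite mul0r.
have [_|y0] /= := eqVneq y 0; first by rewrite mulr0.
rewrite exprMn; have [->|->] := euler_pm1 x0; have [->|->] := euler_pm1 y0;
  by rewrite ?mulrNN ?mulr1 ?mul1r ?eqxx ?[-1 == 1]eq_sym ?one_neqN1 ?mulrN ?mulNr ?mulr1 ?opprK.
Qed.

Lemma quad_char_sq x : x != 0 -> eta x ^+ 2 = 1.
Proof.
by move=> x0; rewrite /eta (negbTE x0); case: ifP => _; rewrite ?sqrrN expr1n.
Qed.

Lemma quad_char_neq0 x : x != 0 -> eta x != 0.
Proof. by move/quad_char_sq/eqP; apply: contraTneq => ->; rewrite expr0n eq_sym oner_eq0. Qed.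

Lemma quad_char0 : eta 0 = 0. Proof. by rewrite /eta eqxx. Qed.

Lemma quad_char_square x : x != 0 -> eta (x ^+ 2) = 1.
Proof. by move=> x0; rewrite expr2 quad_charM -expr2 quad_char_sq. Qed.

Lemma quad_charV x : x != 0 -> eta x^-1 = eta x.
Proof.
move=> x0; apply: (mulfI (quad_char_neq0 x0)); rewrite -quad_charM divff // -expr2 quad_char_sq //.
by rewrite -[in LHS](expr1n _ 2) quad_char_square ?oner_eq0.
Qed.

Lemma quad_char_norm x : x != 0 -> `|eta x| = 1.
Proof. by move=> x0; rewrite /eta (negbTE x0); case: ifP => _; rewrite ?normrN normr1. Qed.

Lemma sqrt_setE (y0 : F) : [set y | y ^+ 2 == y0 ^+ 2] = [set y0; - y0].
Proof. by apply/setP => y; rewrite !inE eqf_sqr. Qed.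

Lemma neq_opp (y : F) : y != 0 -> (y == - y) = false.
Proof.
by move=> y0; apply/negbTE; rewrite -subr_eq0 opprK -mulr2n -mulr_natl mulf_neq0.
Qed.

(** The nonzero squares lie among the at most (q-1)/2 roots of X^((q-1)/2) - 1, and there are at
    least (q-1)/2 of them because squaring is at most two-to-one. *)
Lemma euler_is_square (x : F) : x != 0 -> (x ^+ q.-1./2 == 1) = [exists y, y ^+ 2 == x].
Proof.
pose A := [set x : F | x ^+ q.-1./2 == 1].
pose S := [set y ^+ 2 | y in [set y : F | y != 0]].
have SA : S \subset A.
  apply/subsetP => z /imsetP[y]; rewrite inE => y0 ->; rewrite inE -exprM mulnC exprM.
  by rewrite euler_sq.
have q1 : (1 < q)%N := finNzRing_gt1 F.
have cA : (#|A| <= q.-1./2)%N.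
  have e0 : (0 < q.-1./2)%N.
    have aux n : odd n -> (1 < n -> 0 < n.-1./2)%N by case: n => [|[|[|n]]].
    exact: aux.
  rewrite cardE -ltnS.
  have <- : size ('X^(q.-1./2) - 1%:P : {poly F}) = q.-1./2.+1 by rewrite size_XnsubC.
  apply: max_poly_roots; last exact: enum_uniq.
    by rewrite -size_poly_eq0 size_XnsubC.
  by apply/allP => z; rewrite mem_enum inE rootE !hornerE subr_eq0.
have cS : (q.-1 <= 2 * #|S|)%N.
  have -> : q.-1 = #|[set y : F | y != 0]|.
    by rewrite -(cardC1 (0 : F)); apply: eq_card => y; rewrite !inE.
  rewrite -sum1_card (partition_big (fun y => y ^+ 2) (mem S)) /=; last first.
    by move=> y; rewrite inE => y0; apply/imsetP; exists y; rewrite ?inE.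
  rewrite mulnC -sum_nat_const; apply: leq_sum => _ /imsetP[y0 _ ->].
  rewrite sum1_card; apply: (@leq_trans #|[set y0; - y0]|); last first.
    by rewrite cards2; case: (_ != _).
  by apply/subset_leq_card/subsetP => y; rewrite -sqrt_setE !inE => /andP[].
have /eqP eSA : S == A.
  rewrite eqEcard SA; apply: (leq_trans cA).
  by rewrite -(doubleK #|S|) -mul2n; apply: half_leq.
move=> x0; have -> : (x ^+ q.-1./2 == 1) = (x \in S) by rewrite eSA inE.
apply/imsetP/existsP => [[y _ ->]|[y /eqP e]]; first by exists y.
by exists y; rewrite ?inE -?e //; apply: contraNneq x0 => y0; rewrite -e y0 expr0n.
Qed.

Lemma card_sqrt (x : F) : #|[set y : F | y ^+ 2 == x]|%:R = 1 + eta x.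
Proof.
rewrite /eta; have [->|x0] := eqVneq x 0.
  have -> : [set y : F | y ^+ 2 == 0] = [set 0] by apply/setP => y; rewrite !inE expf_eq0.
  by rewrite cards1 addr0.
rewrite euler_is_square //; case: existsP => [[y0 /eqP e]|nex].
  rewrite -e sqrt_setE cards2 neq_opp ?addn1 //.
  by apply: contraNneq x0 => y00; rewrite -e y00 expr0n.
have -> : [set y : F | y ^+ 2 == x] = set0.
  by apply/setP => y; rewrite !inE; apply/negP => e; case: nex; exists y.
by rewrite cards0 subrr.
Qed.

Variable chi : F -> algC.
Hypotheses (chiD : {morph chi : x y / x + y >-> x * y})
  (chi_norm : forall x, `|chi x| = 1) (chi_nt : exists x, chi x != 1).

Definition gauss_sum : algC := \sum_x chi (x ^+ 2).

Lemma sum_quad_char (f : F -> algC) :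
  \sum_x f (x ^+ 2) = \sum_x (1 + eta x) * f x.
Proof.
rewrite (partition_big (fun x => x ^+ 2) xpredT) //=; apply: eq_bigr => x _.
rewrite -card_sqrt mulr_natl -sumr_const; apply: eq_big => [y|y /eqP-> //].
by rewrite inE.
Qed.

Lemma gauss_sumE : gauss_sum = \sum_x eta x * chi x.
Proof.
rewrite /gauss_sum sum_quad_char; under eq_bigr do rewrite mulrDl mul1r.
rewrite big_split /= [X in X + _](_ : _ = 0) ?add0r //.
rewrite (eq_bigr (fun x => chi (x * 1))); last by move=> x _; rewrite mulr1.
by rewrite add_char_sum // oner_eq0.
Qed.

Lemma gauss_sum_scale s : s != 0 -> \sum_x chi (s * x ^+ 2) = eta s * gauss_sum.
Proof.
move=> s0; rewrite gauss_sumE (sum_quad_char (fun x => chi (s * x))).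
under eq_bigr do rewrite mulrDl mul1r.
rewrite big_split /= [X in X + _](_ : _ = 0) ?add0r; last first.
  by under eq_bigr do rewrite mulrC; rewrite add_char_sum // (negbTE s0).
rewrite mulr_sumr [RHS](reindex_inj (mulfI s0)) /=; apply: eq_bigr => x _.
by rewrite quad_charM !mulrA -expr2 quad_char_sq // mul1r.
Qed.

Lemma gauss_sum_norm : `|gauss_sum| ^+ 2 = q%:R.
Proof.
rewrite normCK /gauss_sum rmorph_sum mulr_suml.
under eq_bigr => x _ do rewrite mulr_sumr (reindex_inj (addrI x)) /=.
rewrite exchange_big /= (bigD1 0) //= [X in _ + X]big1 ?addr0 => [|y y0].
  rewrite (eq_bigr (fun=> 1)); first by rewrite sumr_const.
  by move=> x _; rewrite addr0 -normCK chi_norm expr1n.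
rewrite (eq_bigr (fun x => chi (x * (- (2%:R * y))) * chi (- y ^+ 2))).
  by rewrite -mulr_suml add_char_sum // oppr_eq0 mulf_eq0 (negbTE two0) (negbTE y0) mul0r.
by move=> x _; rewrite -add_charN // -!chiD; congr chi; ring.
Qed.

(* If x + b^2/x = y then x (y + 2b) = (x + b)^2, so eta x = eta (y + 2b) on the fiber. *)
Lemma salie_fiber (b y : F) : b != 0 ->
  \sum_(x | (x != 0) && (x + b ^+ 2 / x == y)) eta x
    = eta (y + 2%:R * b) + eta (y - 2%:R * b).
Proof.
move=> b0.
have four0 : 4%:R != 0 :> F by rewrite -[4%N]/(2 * 2)%N natrM mulf_neq0.
have inv x : x != 0 -> x + b ^+ 2 / x = y -> x * (y + 2%:R * b) = (x + b) ^+ 2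
     /\ x * (y - 2%:R * b) = (x - b) ^+ 2.
  by move=> x0 <-; split; field.
(* The fiber is the root set of x^2 - yx + b^2, and x -> 2x - y maps it onto the square roots of the
   discriminant (y + 2b)(y - 2b). *)
have cnt : \sum_(x | (x != 0) && (x + b ^+ 2 / x == y)) (1 : algC)
     = 1 + eta ((y + 2%:R * b) * (y - 2%:R * b)).
  rewrite sumr_const -card_sqrt; congr (_%:R).
  have inj : injective (fun x : F => 2%:R * x - y).
    by move=> u v /addIr /(mulfI two0).
  rewrite -[LHS](card_imset _ inj); apply: eq_card => z; apply/imsetP/idP.
    move=> [x /andP[x0 /eqP e] ->]; rewrite inE; apply/eqP.
    by rewrite -e; field.
  rewrite inE => /eqP e; exists ((z + y) / 2%:R); last by field.
  have e2 : (z + y) * (y - z) = 4%:R * b ^+ 2.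
    have -> : 4%:R * b ^+ 2 = y ^+ 2 - (y + 2%:R * b) * (y - 2%:R * b) by ring.
    by rewrite -e; ring.
  have zy : z + y != 0.
    apply: contraTneq b0 => zy; move/eqP: e2; rewrite zy mul0r eq_sym mulf_eq0.
    by rewrite (negbTE four0) expf_eq0 => /= ->.
  rewrite unfold_in mulf_neq0 ?invr_eq0 //=; apply/eqP.
  have -> : b ^+ 2 = (z + y) * (y - z) / 4%:R by rewrite e2 mulrAC divff ?mul1r.
  by field; rewrite two0 zy four0.
(* Both signs are needed: y + 2b may vanish, but then y - 2b = -4b does not. *)
have half (e : F) : (e = b \/ e = - b) -> y + 2%:R * e != 0 ->
  \sum_(x | (x != 0) && (x + b ^+ 2 / x == y)) eta x
    = eta (y + 2%:R * e) * (1 + eta ((y + 2%:R * b) * (y - 2%:R * b))).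
  move=> he ye; rewrite -cnt mulr_sumr; apply: eq_bigr => x /andP[x0 /eqP xy].
  have xe : x * (y + 2%:R * e) = (x + e) ^+ 2.
    by case: he => ->; have [h1 h2] := inv x x0 xy; rewrite ?h1 // mulrN h2.
  have xe0 : x + e != 0.
    apply/eqP => h; move: xe; rewrite h expr0n => /eqP.
    by rewrite mulf_eq0 (negbTE x0) (negbTE ye).
  rewrite mulr1; apply: (mulIf (quad_char_neq0 ye)).
  by rewrite -quad_charM xe quad_char_square // -expr2 quad_char_sq.
have [y0|y0] := eqVneq (y + 2%:R * b) 0; last first.
  rewrite (half b) //; last by left.
  by rewrite quad_charM mulrDr mulr1 mulrA -expr2 quad_char_sq // mul1r.
rewrite (half (- b)); [|by right|].
  by rewrite y0 mul0r quad_char0 addr0 mulr1 add0r mulrN.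
have -> : y + 2%:R * - b = (y + 2%:R * b) - 4%:R * b by ring.
by rewrite y0 sub0r oppr_eq0 mulf_neq0.
Qed.

(** For a = 0 this is a Gauss sum. For a nonsquare [a] the substitution x -> a/x changes the sign of
    the sum. For a = b^2, grouping by y = x + a/x turns it into chi(2b) + chi(-2b) times the Gauss
    sum. *)
Lemma salie_bound a : `|\sum_(x | x != 0) eta x * chi (x + a / x)| ^+ 2 <= 4%:R * q%:R.
Proof.
have [->|a0] := eqVneq a 0.
  rewrite (_ : \sum_(x | x != 0) _ = gauss_sum).
    by rewrite gauss_sum_norm ler_peMl ?ler0n // ler1n.
  rewrite gauss_sumE [RHS](bigD1 0) //= quad_char0 mul0r add0r.
  by apply: eq_bigr => x _; rewrite mul0r addr0.
have [/existsP[b /eqP ba]|nsq] := boolP [exists y, y ^+ 2 == a]; last first.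
  set S := \sum_(x | _) _; suff -> : S = 0 by rewrite normr0 expr0n mulr_ge0 ?ler0n.
  have etaa : eta a = -1 by rewrite /eta (negbTE a0) euler_is_square // (negbTE nsq).
  have e : S = - S.
    have inj : injective (fun x : F => a / x) by move=> u v /(mulfI a0)/invr_inj.
    rewrite {1}/S (reindex_inj inj) /= -mulN1r mulr_sumr; apply: eq_big => x.
      by rewrite mulf_eq0 invr_eq0 (negbTE a0).
    move=> x0; have x0' : x != 0 by move: x0; rewrite mulf_eq0 invr_eq0 (negbTE a0).
    rewrite quad_charM quad_charV // etaa mulrA; congr (_ * chi _).
    by rewrite addrC; congr (_ + _); field; rewrite x0' a0.
  have /eqP : S *+ 2 = 0 by rewrite mulr2n {2}e subrr.
  by rewrite mulrn_eq0 => /eqP.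
have b0 : b != 0 by apply: contraNneq a0 => b0; rewrite -ba b0 expr0n.
have -> : \sum_(x | x != 0) eta x * chi (x + a / x)
     = (chi (- (2%:R * b)) + chi (2%:R * b)) * gauss_sum.
  rewrite (partition_big (fun x => x + a / x) xpredT) //=.
  rewrite (eq_bigr (fun y => eta (y + 2%:R * b) * chi y + eta (y - 2%:R * b) * chi y)).
    rewrite big_split /= gauss_sumE [RHS]mulrDl !mulr_sumr; congr (_ + _).
      rewrite [RHS](reindex_inj (addIr (2%:R * b))) /=; apply: eq_bigr => y _.
      by rewrite mulrCA -chiD; congr (_ * chi _); ring.
    rewrite [RHS](reindex_inj (addIr (- (2%:R * b)))) /=; apply: eq_bigr => y _.
    by rewrite mulrCA -chiD; congr (_ * chi _); ring.
  move=> y _; rewrite -mulrDl -salie_fiber // mulr_suml ba.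
  by apply: eq_bigr => x /andP[_ /eqP ->].
rewrite normrM exprMn gauss_sum_norm ler_pM2r ?ltr0n; last exact: ltnW (finNzRing_gt1 F).
have le2 : `|chi (- (2%:R * b)) + chi (2%:R * b)| <= 2%:R.
  by apply: (le_trans (ler_normD _ _)); rewrite !chi_norm.
by rewrite -[4%N]/(2 * 2)%N natrM expr2; apply: ler_pM.
Qed.

(** Parity of [d] decides between Salie and Kloosterman sums. The value a = 0 is included because
    frequencies of norm 0 produce it. *)
Lemma twisted_kloosterman_bound d a :
  `|\sum_(x | x != 0) eta x ^+ d * chi (x + a / x)| ^+ 2 <= 4%:R * q%:R.
Proof.
have [odd_d|even_d] := boolP (odd d).
  rewrite (eq_bigr (fun x => eta x * chi (x + a / x))) ?salie_bound // => x x0.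
  by rewrite -(odd_double_half d) odd_d add1n exprS -mul2n exprM quad_char_sq // expr1n mulr1.
rewrite (eq_bigr (fun x => chi (x + a / x))) => [|x x0]; last first.
  by rewrite -(odd_double_half d) (negbTE even_d) add0n -mul2n exprM quad_char_sq // expr1n mul1r.
have [->|a0] := eqVneq a 0.
  have := add_char_sum chiD chi_norm chi_nt 1; rewrite oner_eq0 (bigD1 0) //= mul0r add_char0 //.
  move/eqP; rewrite addrC addr_eq0 => /eqP e.
  rewrite (eq_bigr (fun x => chi (x * 1))) => [|x _]; last by rewrite mul0r addr0 mulr1.
  rewrite e normrN normr1 expr1n -natrM ler1n muln_gt0 /=.
  exact: ltnW (finNzRing_gt1 F).
have := kloosterman_bound chiD chi_norm chi_nt two0 a0.
rewrite -real_normK ?kloosterman_real // /kloosterman.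
by rewrite (eq_bigl (fun x => x != 0)) // => x; rewrite in_setT.
Qed.

End QuadraticCharacter.

(** * Pairs at a given distance *)

Lemma add_char_exists (F : finFieldType) : exists chi : F -> algC,
  [/\ {morph chi : x y / x + y >-> x * y}, forall x, `|chi x| = 1 & exists x, chi x != 1].
Proof.
have abF : abelian [set: F] by apply: FinRing.zmod_abelian.
have n1 : (1 < Nirr [set: F])%N.
  rewrite NirrE; move: abF; rewrite card_classes_abelian => /eqP->.
  by rewrite cardsT finNzRing_gt1.
pose i : Iirr [set: F] := inord 1.
have i0 : i != 0 by apply/eqP => /(congr1 val); rewrite /= inordK // prednK // ltnW.
have lin : 'chi_i \is a linear_char by exact: (char_abelianP _ abF).
exists (fun x => 'chi_i x); split.
- by move=> x y; rewrite -FinRing.zmodMgE lin_charM ?inE.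
- by move=> x; rewrite normC_lin_char ?inE.
apply/existsP; apply: contraNT i0; rewrite negb_exists => /forallP all1.
rewrite -irr_eq1; apply/eqP/cfunP => x.
by have := all1 x; rewrite negbK cfun1E in_setT => /eqP.
Qed.

(** Lagrange's identity; realness of the entries makes the squares nonnegative, so that the
    inequality is available in [algC]. *)
Lemma sum_cauchy_schwarz (R : numDomainType) (I : finType) (a b : I -> R) :
  (forall i, a i \is Num.real) -> (forall i, b i \is Num.real) ->
  (\sum_i a i * b i) ^+ 2 <= (\sum_i a i ^+ 2) * (\sum_i b i ^+ 2).
Proof.
move=> aR bR.
have : 0 <= \sum_i \sum_j (a i * b j - a j * b i) ^+ 2.
  apply: sumr_ge0 => i _; apply: sumr_ge0 => j _.
  by rewrite real_exprn_even_ge0 // rpredB // rpredM.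
have -> : \sum_i \sum_j (a i * b j - a j * b i) ^+ 2 =
   ((\sum_i a i ^+ 2) * (\sum_i b i ^+ 2) - (\sum_i a i * b i) ^+ 2) *+ 2.
  have eA : (\sum_i a i ^+ 2) * (\sum_i b i ^+ 2) = \sum_i \sum_j a i ^+ 2 * b j ^+ 2.
    by rewrite big_distrlr.
  have eA' : (\sum_i a i ^+ 2) * (\sum_i b i ^+ 2) = \sum_i \sum_j b i ^+ 2 * a j ^+ 2.
    by rewrite mulrC big_distrlr.
  have eC : (\sum_i a i * b i) ^+ 2 = \sum_i \sum_j (a i * b i) * (a j * b j).
    by rewrite expr2 big_distrlr.
  rewrite mulr2n {1}eA eA' eC -!sumrB -big_split; apply: eq_bigr => i _.
  by rewrite -!sumrB -big_split; apply: eq_bigr => j _ /=; ring.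
by rewrite pmulrn_lge0 // subr_ge0.
Qed.

Section Fourier.
Variables (F : finFieldType) (d : nat) (chi : F -> algC).
Local Notation q := #|F|.
Local Notation V := 'rV[F]_d.
Hypotheses (chiD : {morph chi : x y / x + y >-> x * y})
  (chi_norm : forall x, `|chi x| = 1) (chi_nt : exists x, chi x != 1).

Definition dotv (x y : V) : F := \sum_i x 0 i * y 0 i.

Lemma sum_rV_prod (f : 'I_d -> F -> algC) :
  \sum_(x : V) \prod_i f i (x 0 i) = \prod_i \sum_c f i c.
Proof.
rewrite bigA_distr_bigA /= (reindex (fun x : V => [ffun i => x 0 i])) /=.
  by apply: eq_bigr => x _; apply: eq_bigr => i _; rewrite ffunE.
exists (fun g : {ffun 'I_d -> F} => \row_i g i) => [x _|g _].
  by apply/rowP => i; rewrite mxE ffunE.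
by apply/ffunP => i; rewrite ffunE mxE.
Qed.

Lemma add_char_big (f : 'I_d -> F) : chi (\sum_i f i) = \prod_i chi (f i).
Proof. by rewrite (big_morph chi (id1 := 1) (op1 := *%R)) // add_char0. Qed.

Lemma dotvBr x y z : dotv x (y - z) = dotv x y - dotv x z.
Proof. by rewrite /dotv -sumrB; apply: eq_bigr => i _; rewrite !mxE mulrBr. Qed.

Lemma char_dotv_sum (z : V) : \sum_x chi (dotv x z) = if z == 0 then (q ^ d)%:R else 0.
Proof.
under eq_bigr do rewrite /dotv add_char_big.
rewrite (sum_rV_prod (fun i c => chi (c * z 0 i))).
have [->|z0] := eqVneq z 0.
  rewrite (eq_bigr (fun=> q%:R)); first by rewrite prodr_const card_ord natrX.
  by move=> i _; rewrite add_char_sum // mxE eqxx.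
have [i zi] : exists i, z 0 i != 0.
  apply/existsP; apply: contraNT z0; rewrite negb_exists => /forallP all0.
  by apply/eqP/rowP => i; have := all0 i; rewrite negbK mxE => /eqP.
by rewrite (bigD1 i) //= add_char_sum // (negbTE zi) mul0r.
Qed.

Definition fourier (U : {set V}) (x : V) : algC := \sum_(u in U) chi (dotv x u).

Lemma plancherel U : \sum_x `|fourier U x| ^+ 2 = (q ^ d)%:R * #|U|%:R.
Proof.
have -> : \sum_x `|fourier U x| ^+ 2
   = \sum_(u in U) \sum_(v in U) \sum_x chi (dotv x (u - v)).
  rewrite [RHS](eq_bigr (fun u => \sum_x \sum_(v in U) chi (dotv x (u - v)))) => [|u _]; last first.
    by rewrite exchange_big.
  rewrite [RHS]exchange_big /=; apply: eq_bigr => x _.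
  rewrite normCK /fourier rmorph_sum mulr_suml; apply: eq_bigr => u _.
  rewrite mulr_sumr; apply: eq_bigr => v _.
  by rewrite dotvBr chiD (add_charN chiD chi_norm).
rewrite (eq_bigr (fun=> (q ^ d)%:R)) => [|u uU]; first by rewrite sumr_const mulr_natr.
rewrite (bigD1 u) //= char_dotv_sum subrr eqxx big1 ?addr0 // => v /andP[_ vu].
by rewrite char_dotv_sum subr_eq0 eq_sym (negbTE vu).
Qed.

Hypotheses (two0 : 2%:R != 0 :> F) (q_odd : odd q).
Local Notation eta := (@quad_char F).
Local Notation G := (gauss_sum chi).

(** The sum factors over coordinates. The shift c -> c + 2 s z_i leaves a Gauss sum of coefficient
    -1/(4s), and this coefficient has the same quadratic character as -s. *)
Lemma complete_square (s : F) (z : V) : s != 0 ->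
  \sum_x chi (dotv x z) * chi (- (qnorm x / (4%:R * s))) = (eta (- s) * G) ^+ d * chi (s * qnorm z).
Proof.
move=> s0; have four0 : 4%:R != 0 :> F by rewrite -[4%N]/(2 * 2)%N natrM mulf_neq0.
rewrite (eq_bigr (fun x : V => \prod_i chi (x 0 i * z 0 i - x 0 i ^+ 2 / (4%:R * s)))); last first.
  move=> x _; rewrite -chiD -add_char_big; congr chi.
  by rewrite sumrB /dotv /qnorm mulr_suml.
rewrite (sum_rV_prod (fun i c => chi (c * z 0 i - c ^+ 2 / (4%:R * s)))).
rewrite /qnorm [s * _]mulr_sumr add_char_big.
rewrite (eq_bigr (fun i => (eta (- s) * G) * chi (s * z 0 i ^+ 2))); last first.
  move=> i _; rewrite (reindex_inj (addIr (2%:R * s * z 0 i))) /=.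
  have e : eta (- s) = eta (- (4%:R * s)^-1).
    rewrite -invrN quad_charV ?oppr_eq0 ?mulf_neq0 // -mulrN quad_charM //.
    have -> : 4%:R = 2%:R ^+ 2 :> F by rewrite -natrX.
    by rewrite quad_char_square // mul1r.
  rewrite e -gauss_sum_scale ?oppr_eq0 ?invr_eq0 ?mulf_neq0 // mulr_suml.
  apply: eq_bigr => c _; rewrite -chiD; congr chi.
  by field; rewrite s0 four0.
by rewrite big_split /= prodr_const card_ord.
Qed.

Definition sphere_pairs (t : F) (U W : {set V}) : {set V * V} :=
  [set p in setX U W | qnorm (p.1 - p.2) == t].

(** The condition of being at distance t is detected by a sum over s, whose term s = 0 gives the
    main term |U| |W|. For the others, [complete_square] is read backwards; this is what costs the
    factor G^d, kept on the left to avoid dividing. *)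
Lemma sphere_pairs_fourier t U W :
  G ^+ d * (q%:R * #|sphere_pairs t U W|%:R - (#|U| * #|W|)%:R) =
  \sum_x (\sum_(s | s != 0) eta (- s) ^+ d * chi (- s * t - qnorm x / (4%:R * s)))
         * (fourier U x * (fourier W x)^*).
Proof.
have -> : q%:R * #|sphere_pairs t U W|%:R = 
   \sum_(p in setX U W) \sum_s chi (s * (qnorm (p.1 - p.2) - t)).
  under eq_bigr do rewrite add_char_sum // subr_eq0.
  rewrite -big_mkcondr /= sumr_const mulr_natr; congr (_ *+ _).
  by apply: eq_card => p; rewrite [LHS]inE.
have -> : \sum_(p in setX U W) \sum_s chi (s * (qnorm (p.1 - p.2) - t)) =
   (#|U| * #|W|)%:R + \sum_(p in setX U W) \sum_(s | s != 0) chi (s * (qnorm (p.1 - p.2) - t)).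
  rewrite -cardsX -sumr_const -big_split /=; apply: eq_bigr => p _.
  by rewrite (bigD1 0) //= mul0r add_char0.
rewrite addrAC subrr add0r.
under [RHS]eq_bigr => x _ do rewrite mulr_suml.
rewrite [RHS]exchange_big /= exchange_big /= mulr_sumr; apply: eq_bigr => s s0.
rewrite mulr_sumr.
have -> : \sum_i eta (- s) ^+ d * chi (- s * t - qnorm i / (4%:R * s))
              * (fourier U i * (fourier W i)^*)
  = \sum_(p in setX U W) eta (- s) ^+ d * chi (- s * t) *
     (\sum_x chi (dotv x (p.1 - p.2)) * chi (- (qnorm x / (4%:R * s)))).
  under [RHS]eq_bigr do rewrite mulr_sumr.
  rewrite [RHS]exchange_big /=; apply: eq_bigr => x _.
  have -> : fourier U x * (fourier W x)^* = \sum_(p in setX U W) chi (dotv x (p.1 - p.2)).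
    rewrite /fourier rmorph_sum big_distrlr /= pair_big /=; apply: eq_big => [[u v]|[u v] _ /=].
      by rewrite in_setX.
    by rewrite dotvBr chiD (add_charN chiD chi_norm).
  rewrite mulr_sumr; apply: eq_bigr => p _; rewrite chiD; ring.
apply: eq_bigr => p _; rewrite complete_square // exprMn.
have e1 : eta (- s) ^+ d * eta (- s) ^+ d = 1.
  by rewrite -exprMn -expr2 quad_char_sq ?oppr_eq0 // expr1n.
have -> : s * (qnorm (p.1 - p.2) - t) = - s * t + s * qnorm (p.1 - p.2) by ring.
rewrite chiD.
transitivity (eta (- s) ^+ d * eta (- s) ^+ d
  * (G ^+ d * (chi (- s * t) * chi (s * qnorm (p.1 - p.2))))).
  by rewrite e1 mul1r.
by ring.
Qed.

(** The substitution x = -st gives a twisted Kloosterman sum of parameter ct/4, up to the sign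
    eta(t)^d. *)
Lemma sphere_kernel_bound t c : t != 0 ->
  `|\sum_(s | s != 0) eta (- s) ^+ d * chi (- s * t - c / (4%:R * s))| ^+ 2 <= 4%:R * q%:R.
Proof.
move=> t0; have four0 : 4%:R != 0 :> F by rewrite -[4%N]/(2 * 2)%N natrM mulf_neq0.
have := twisted_kloosterman_bound two0 q_odd chiD chi_norm chi_nt d (c * t / 4%:R).
set K := \sum_(s | _) eta (- s) ^+ d * _; set T := \sum_(x | _) _.
suff -> : T = eta t ^+ d * K by rewrite normrM normrX quad_char_norm // expr1n mul1r.
have nt0 : - t != 0 by rewrite oppr_eq0.
rewrite /T (reindex_inj (mulIf nt0)) /= mulr_sumr.
apply: eq_big => s; first by rewrite mulf_eq0 (negbTE nt0) orbF.
rewrite mulf_eq0 (negbTE nt0) orbF => s0.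
rewrite mulrA -exprMn -quad_charM //; congr (eta _ ^+ d * chi _); first by ring.
by field; rewrite s0 nt0 four0.
Qed.

Lemma sphere_pairs_bound t U W : t != 0 ->
  (q%:R * #|sphere_pairs t U W|%:R - (#|U| * #|W|)%:R) ^+ 2
     <= 4%:R * q%:R ^+ d.+1 * (#|U| * #|W|)%:R :> algC.
Proof.
move=> t0; set X : algC := _ - _.
have XR : X \is Num.real by rewrite rpredB ?rpredM ?realn.
pose k x := \sum_(s | s != 0) eta (- s) ^+ d * chi (- s * t - qnorm x / (4%:R * s)).
have q0 : 0 < q%:R :> algC by rewrite ltr0n (ltnW (finNzRing_gt1 F)).
have lhs : q%:R ^+ d * X ^+ 2 = `|G ^+ d * X| ^+ 2.
  rewrite normrM exprMn (real_normK XR) normrX -exprM mulnC exprM.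
  by rewrite gauss_sum_norm.
have le1 : `|G ^+ d * X| <= \sum_x sqrtC (4%:R * q%:R) * `|fourier U x| * `|fourier W x|.
  rewrite sphere_pairs_fourier; apply: (le_trans (ler_norm_sum _ _ _)).
  apply: ler_sum => x _; rewrite !normrM norm_conjC mulrA.
  rewrite !ler_wpM2r //.
  have s0 : 0 <= sqrtC (4%:R * q%:R) :> algC by rewrite sqrtC_ge0 mulr_ge0 ?ler0n.
  rewrite -(@ler_pXn2r _ 2) ?nnegrE // sqrtCK; exact: sphere_kernel_bound.
have le2 : `|G ^+ d * X| ^+ 2 <= 4%:R * q%:R * ((q ^ d)%:R * #|U|%:R * ((q ^ d)%:R * #|W|%:R)).
  apply: (le_trans (ler_pM (normr_ge0 _) (normr_ge0 _) le1 le1)).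
  under eq_bigr do rewrite -mulrA.
  rewrite -mulr_sumr -expr2 exprMn sqrtCK ler_wpM2l ?mulr_ge0 ?ler0n //.
  rewrite -!plancherel; apply: sum_cauchy_schwarz => x; exact: normr_real.
move: le2; rewrite -lhs => le2.
rewrite -(ler_pM2l (exprn_gt0 d q0)); apply: (le_trans le2).
rewrite le_eqVlt; apply/orP; left; apply/eqP; rewrite !natrX natrM exprS; ring.
Qed.

End Fourier.

Lemma odd_card_two_neq0 (F : finFieldType) : odd #|F| -> 2%:R != 0 :> F.
Proof.
move=> q_odd; have [p p_pr pF] := finPcharP F.
rewrite -(dvdn_pcharf pF); apply/negP => p2.
have e2 : p = 2%N by apply/eqP; rewrite -dvdn_prime2.
have [n eF] : exists n, #|F| = (2 ^ n)%N.
  by rewrite -e2; exists (logn p #|F|); exact: card_pprimeChar pF.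
move: q_odd (finNzRing_gt1 F); rewrite eF oddX orbF => /eqP->.
by rewrite expn0.
Qed.

(** If the count falls below half of its expected value, the deviation is at least X/2 with X = |U|
    |W|, so X^2 / 4 <= 4 q^(d+1) X. *)
Lemma few_sphere_pairs (F : finFieldType) (d : nat) (t : F) (U W : {set 'rV[F]_d}) :
  odd #|F| -> t != 0 ->
  (2 * (#|F| * #|sphere_pairs t U W|) <= #|U| * #|W| ->
   #|U| * #|W| <= 16 * #|F| ^ d.+1)%N.
Proof.
move=> q_odd t0 small.
have two0 := odd_card_two_neq0 q_odd.
have [chi [chiD chi_norm chi_nt]] := add_char_exists F.
have := sphere_pairs_bound chiD chi_norm chi_nt two0 q_odd U W t0.
set X := (#|U| * #|W|)%N in small *; set N := #|sphere_pairs _ _ _| in small *.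
have le1 : (#|F| * N <= X)%N by lia.
rewrite -natrM -opprB sqrrN -natrB // -!natrX -!natrM ler_nat => le2.
have [->//|X0] := posnP X.
by rewrite -(leq_pmul2r X0); nia.
Qed.

(** * Affine independence and sections of spheres *)

Section Affine.
Variables (F : finFieldType) (d : nat).
Local Notation q := #|F|.
Local Notation V := 'rV[F]_d.
Implicit Types (A B : {set V}) (x y z a : V) (t : F).

Lemma affinely_independentP A :
  reflect (forall c : V -> F, \sum_(x in A) c x = 0 -> \sum_(x in A) c x *: x = 0 ->
            forall x, x \in A -> c x = 0) (affinely_independent A).
Proof.
apply: (iffP forallP) => [indA c c0 cx0 x xA|indA c].
  have := indA [ffun x => c x]; rewrite (eq_bigr c) => [|y _]; last by rewrite ffunE.
  rewrite (eq_bigr (fun y => c y *: y)) => [|y _]; last by rewrite ffunE.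
  by rewrite c0 cx0 !eqxx /= => /forall_inP/(_ x xA); rewrite ffunE => /eqP.
apply/implyP => /andP[/eqP c0 /eqP cx0]; apply/forall_inP => x xA.
by apply/eqP; exact: indA c0 cx0 x xA.
Qed.

Lemma affinely_independentS A B :
  A \subset B -> affinely_independent B -> affinely_independent A.
Proof.
move=> AB /affinely_independentP indB; apply/affinely_independentP => c c0 cx0 x xA.
pose c' z := if z \in A then c z else 0.
have eAB (G : zmodType) (f : V -> G) :
    \sum_(z in B) (if z \in A then f z else 0) = \sum_(z in A) f z.
  rewrite -big_mkcondr; apply: eq_bigl => z /=; rewrite andb_idl //.
  exact: (subsetP AB).
have := indB c' _ _ x (subsetP AB x xA); rewrite /c' xA; apply.
  by rewrite eAB.
rewrite -[RHS]cx0 -[RHS]eAB; apply: eq_bigr => z _.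
by case: ifP; rewrite ?scale0r.
Qed.

Lemma affinely_independent1 x : affinely_independent [set x].
Proof. by apply/affinely_independentP => c; rewrite big_set1 => c0 _ y /set1P ->. Qed.

(** The disjunction expresses that [a] lies in the affine span of [B]. Its second half is needed
    because for [a] in [B] the set [a |: B] is [B], which is independent. *)
Lemma affine_combination B a : affinely_independent B ->
  ~~ affinely_independent (a |: B) \/ a \in B ->
  exists c : V -> F, \sum_(z in B) c z = 1 /\ \sum_(z in B) c z *: z = a.
Proof.
move=> indB; have [aB _|aB [|//]] := boolP (a \in B).
  exists (fun z => (z == a)%:R); split.
    by rewrite (bigD1 a) //= eqxx big1 ?addr0 // => z /andP[_ /negbTE->].
  rewrite (bigD1 a) //= eqxx scale1r big1 ?addr0 // => z /andP[_ /negbTE->].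
  by rewrite scale0r.
case/forallPn => c; rewrite negb_imply => /andP[/andP[/eqP c0 /eqP cx0]].
rewrite big_setU1 //= in c0; rewrite big_setU1 //= in cx0.
have [ca|ca nz] := eqVneq (c a) 0.
  move: c0 cx0; rewrite ca scale0r !add0r => c0 cx0 /forall_inPn[x].
  rewrite inE => /orP[/set1P->|xB]; first by rewrite ca eqxx.
  by rewrite (elimT (affinely_independentP B) indB _ c0 cx0 x xB) eqxx.
exists (fun z => - (c z / c a)); split.
  rewrite sumrN -mulr_suml; move/eqP: c0; rewrite addrC addr_eq0 => /eqP->.
  by rewrite mulNr opprK divff.
rewrite (eq_bigr (fun z => (- (c a)^-1) *: (c z *: z))) => [|z _]; last first.
  by rewrite scalerA mulNr mulrC.
rewrite -scaler_sumr; move/eqP: cx0; rewrite addrC addr_eq0 => /eqP->.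
by rewrite scalerN scaleNr opprK scalerA mulVf // scale1r.
Qed.

Lemma aff_witness A : exists B, [/\ B \subset A, affinely_independent B & #|B| = aff A].
Proof.
have ind0 : affinely_independent (set0 : {set V}).
  by apply/affinely_independentP => c _ _ x; rewrite inE.
have c0 : (0 < #|[pred B : {set V} | (B \subset A) && affinely_independent B]|)%N.
  by apply/card_gt0P; exists set0; rewrite inE sub0set.
have [B /andP[BA indB] e] := eq_bigmax_cond (fun B : {set V} => #|B|) c0.
by exists B; split=> //; rewrite -e.
Qed.

Lemma aff_ge A B : B \subset A -> affinely_independent B -> (#|B| <= aff A)%N.
Proof. by move=> BA indB; rewrite /aff; apply: leq_bigmax_cond; rewrite BA. Qed.

Lemma aff_subset A r : (r <= aff A)%N ->
  exists B, [/\ B \subset A, affinely_independent B & #|B| = r].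
Proof.
have [B [BA indB <-]] := aff_witness A => rB.
exists [set z in take r (enum B)].
have sub : [set z in take r (enum B)] \subset B.
  by apply/subsetP => z; rewrite inE => /mem_take; rewrite mem_enum.
split; first exact: subset_trans BA.
  exact: affinely_independentS indB.
rewrite cardsE (card_uniqP _) ?take_uniq ?enum_uniq //.
by rewrite size_takel // -cardE.
Qed.

Lemma affS A B : A \subset B -> (aff A <= aff B)%N.
Proof.
move=> AB; have [C [CA indC <-]] := aff_witness A.
by apply: aff_ge indC; exact: subset_trans AB.
Qed.

Lemma card_le_aff A : (#|A| <= q ^ (aff A).-1)%N.
Proof.
have [->|[a0 a0A]] := set_0Vmem A; first by rewrite cards0.
have [B [BA indB cB]] := aff_witness A.
have aff1 : (0 < aff A)%N.
  by rewrite -(cards1 a0); apply: aff_ge; rewrite ?sub1set // affinely_independent1.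
have [b0 b0B] : exists b, b \in B by apply/card_gt0P; rewrite cB.
pose f (c : {ffun 'I_#|B :\ b0| -> F}) : V := b0 + \sum_i c i *: (enum_val i - b0).
have cBb : #|B :\ b0| = (aff A).-1.
  by have := cardsD1 b0 B; rewrite b0B cB => ->.
have -> : (q ^ (aff A).-1 = #|{: {ffun 'I_#|B :\ b0| -> F}}|)%N.
  by rewrite card_ffun card_ord cBb.
apply: leq_trans (leq_imset_card f _); apply/subset_leq_card/subsetP => a aA.
have [|c [c1 ca]] := @affine_combination B a indB.
  have [aB|aB] := boolP (a \in B); first by right.
  left; apply/negP => ind; have := aff_ge (_ : a |: B \subset A) ind.
  by rewrite cardsU1 aB cB ltnn => /(_ _)/negP; apply; rewrite // subUset sub1set aA.
apply/imsetP; exists [ffun i => c (enum_val i)] => //.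
rewrite /f (eq_bigr (fun i : 'I_#|B :\ b0| => c (enum_val i) *: (enum_val i - b0))); last first.
  by move=> i _; rewrite ffunE.
rewrite -(big_enum_val (fun z => c z *: (z - b0))) /=.
have -> : \sum_(z in B :\ b0) c z *: (z - b0) = \sum_(z in B) c z *: (z - b0).
  by rewrite [RHS](big_setD1 b0) //= subrr scaler0 add0r.
rewrite (eq_bigr (fun z => c z *: z - c z *: b0)) => [|z _]; last by rewrite scalerBr.
by rewrite sumrB ca -scaler_suml c1 scale1r addrC subrK.
Qed.

Lemma qnormD x y : qnorm (x + y) = qnorm x + 2%:R * dotv x y + qnorm y.
Proof.
rewrite /qnorm /dotv mulr_sumr -!big_split; apply: eq_bigr => i _ /=.
by rewrite !mxE; ring.
Qed.

Lemma dotvC x y : dotv x y = dotv y x.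
Proof. by apply: eq_bigr => i _; rewrite mulrC. Qed.

Lemma dotvZr (c : F) x y : dotv x (c *: y) = c * dotv x y.
Proof. by rewrite /dotv mulr_sumr; apply: eq_bigr => i _; rewrite !mxE mulrCA. Qed.

Lemma dotvDl x y z : dotv (x + y) z = dotv x z + dotv y z.
Proof. by rewrite /dotv -big_split; apply: eq_bigr => i _; rewrite !mxE mulrDl. Qed.

Lemma qnormZ (c : F) x : qnorm (c *: x) = c ^+ 2 * qnorm x.
Proof. by rewrite /qnorm mulr_sumr; apply: eq_bigr => i _; rewrite !mxE exprMn. Qed.

Lemma qnormN x : qnorm (- x) = qnorm x.
Proof. by apply: eq_bigr => i _; rewrite !mxE sqrrN. Qed.

Lemma qnormB x y : qnorm (x - y) = qnorm x - 2%:R * dotv x y + qnorm y.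
Proof.
by rewrite qnormD qnormN -scaleN1r dotvZr mulN1r mulrN.
Qed.

Lemma qnormB_affine B (c : V -> F) x y :
  \sum_(z in B) c z = 1 ->
  qnorm (x - \sum_(z in B) c z *: z) - qnorm (y - \sum_(z in B) c z *: z)
    = \sum_(z in B) c z * (qnorm (x - z) - qnorm (y - z)).
Proof.
move=> c1; rewrite !qnormB.
have lin u : dotv u (\sum_(z in B) c z *: z) = \sum_(z in B) c z * dotv u z.
  rewrite (big_morph (dotv u) (id1 := 0) (op1 := +%R)).
  - by apply: eq_bigr => z _; rewrite dotvZr.
  - by move=> v w; rewrite ![dotv u _]dotvC dotvDl.
  - by rewrite -(scale0r 0) dotvZr mul0r.
rewrite !lin.
have -> : \sum_(z in B) c z * (qnorm (x - z) - qnorm (y - z)) =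
   (\sum_(z in B) c z) * (qnorm x - qnorm y)
   - 2%:R * (\sum_(z in B) c z * dotv x z) + 2%:R * (\sum_(z in B) c z * dotv y z).
  rewrite mulr_suml !mulr_sumr -sumrB -big_split; apply: eq_bigr => z _ /=.
  by rewrite !qnormB; ring.
by rewrite c1; ring.
Qed.

(* w |-> |x - w| - |y - w| is an affine function, so it vanishes on the affine span of B. *)
Lemma sphere_affine_span B z t x y :
  affinely_independent B -> ~~ affinely_independent (z |: B) \/ z \in B ->
  (forall w, w \in B -> qnorm (x - w) = t /\ qnorm (y - w) = t) ->
  qnorm (y - z) = t -> qnorm (x - z) = t.
Proof.
move=> indB zB eq_t yz; have [c [c1 cz]] := affine_combination indB zB.
have := qnormB_affine x y c1; rewrite cz big1.
  by rewrite yz => /eqP; rewrite subr_eq0 => /eqP.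
by move=> w wB; have [-> ->] := eq_t w wB; rewrite subrr mulr0.
Qed.

Definition sphere_section B t : {set V} := [set x | [forall z in B, qnorm (x - z) == t]].

Hypothesis two0 : 2%:R != 0 :> F.

(* The section lies in p + W with dim W = d - |B| + 1.  Unless W is totally isotropic and
   orthogonal to p, some direction in W gives lines meeting the sphere in at most 2 points;
   and 2 |B| <= d + 2 leaves no room for W and p inside the orthogonal space of W. *)
Lemma sphere_section_bound B t :
  (0 < d)%N -> t != 0 -> affinely_independent B -> (0 < #|B|)%N -> (2 * #|B| <= d + 2)%N ->
  (#|sphere_section B t| <= 2 * q ^ (d - #|B|))%N.
Proof.
move=> d0 t0 /affinely_independentP indB /card_gt0P[z0 z0B] Bd.
set X := sphere_section B t.
have [->|[p pX]] := set_0Vmem X; first by rewrite cards0.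
pose B' := B :\ z0; set l := #|B'|.
have Bl : #|B| = l.+1 by rewrite /l (cardsD1 z0 B) z0B.
pose Z : 'M[F]_(l, d) := \matrix_i (enum_val i - z0 : V).
have rZ : row_free Z.
  apply: inj_row_free => v vZ.
  pose c0 z := \sum_(i : 'I_l | enum_val i == z) v 0 i.
  have c0E i : c0 (enum_val i) = v 0 i.
    by rewrite /c0 (big_pred1 i) // => j; apply/eqP/eqP => [/enum_val_inj|->].
  pose c z := if z == z0 then - \sum_i v 0 i else c0 z.
  have cB' (G : zmodType) (f : F -> V -> G) :
      \sum_(z in B') f (c z) z = \sum_(i < l) f (v 0 i) (enum_val i).
    rewrite -/l (big_enum_val (fun z => f (c z) z)) /=; apply: eq_bigr => i _.
    rewrite /c ifN ?c0E //; have := enum_valP i; by rewrite !inE => /andP[].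
  apply/rowP => i; rewrite mxE.
  have iB : enum_val i \in B by have := enum_valP i; rewrite !inE => /andP[].
  have iz : enum_val i != z0 by have := enum_valP i; rewrite !inE => /andP[].
  have := indB c _ _ (enum_val i) iB; rewrite /c (negbTE iz) c0E; apply.
    by rewrite (big_setD1 z0) //= eqxx (cB' _ (fun s _ => s)) addNr.
  rewrite (big_setD1 z0) //= eqxx (cB' _ (fun s z => s *: z)).
  move: vZ; rewrite mulmx_sum_row.
  rewrite (eq_bigr (fun i => v 0 i *: enum_val i - v 0 i *: z0)) => [|j _]; last first.
    by rewrite rowK scalerBr.
  by rewrite sumrB -scaler_suml addrC scaleNr.
pose W := kermx Z^T.
have rW : \rank W = (d - l)%N by rewrite mxrank_ker mxrank_tr (eqP rZ).
have XW x : x \in X -> (x - p <= W)%MS.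
  move=> xX; apply/sub_kermxP/rowP => i; rewrite !mxE.
  rewrite (_ : \sum_j _ = dotv (x - p) (enum_val i - z0)); last first.
    by apply: eq_bigr => j _; rewrite !mxE.
  have iB : enum_val i \in B by have := enum_valP i; rewrite !inE => /andP[].
  move: xX pX; rewrite !inE => /forall_inP xX /forall_inP pX.
  have := xX _ iB; have := xX _ z0B; have := pX _ iB; have := pX _ z0B.
  rewrite !qnormB dotvBr dotvDl ![dotv (x - p) _]dotvDl -scaleN1r ![dotv (_ *: _) _]dotvC !dotvZr.
  rewrite ![dotv _ p]dotvC => /eqP e1 /eqP e2 /eqP e3 /eqP e4.
  apply: (mulfI two0); rewrite mulr0.
  transitivity ((qnorm x - 2%:R * dotv x z0 + qnorm z0)
    - (qnorm x - 2%:R * dotv x (enum_val i) + qnorm (enum_val i))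
    - ((qnorm p - 2%:R * dotv p z0 + qnorm z0)
       - (qnorm p - 2%:R * dotv p (enum_val i) + qnorm (enum_val i)))).
    by ring.
  by rewrite e1 e2 e3 e4 !subrr.
pose p0 := p - z0.
have p0t : qnorm p0 = t by move: pX; rewrite inE => /forall_inP/(_ _ z0B)/eqP.
(* Along a line in direction [v] the sphere equation is a polynomial of degree at most 2 in the
   parameter. Up to a factor these are its quadratic and linear coefficients, and one of them has to
   be nonzero on every such line. *)
have [v vW vP] : exists2 v, (v <= W)%MS &
    forall w, (w <= W)%MS -> (qnorm v != 0) || (dotv (p0 + w) v != 0).
  have [/existsP[v /andP[vW v0]]|iso] := boolP [exists v : V, (v <= W)%MS && (qnorm v != 0)].
    by exists v => // w _; rewrite v0.
  have iso0 v : (v <= W)%MS -> qnorm v = 0.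
    move=> vW; apply/eqP; apply: contraNT iso => v0; apply/existsP; exists v.
    by rewrite vW.
  have iso2 v w : (v <= W)%MS -> (w <= W)%MS -> dotv v w = 0.
    move=> vW wW; have := iso0 _ (addmx_sub vW wW).
    rewrite qnormD !iso0 // add0r addr0 => /eqP; rewrite mulf_eq0 (negbTE two0).
    by move/eqP.
  have [/existsP[v /andP[vW v0]]|perp] := boolP [exists v : V, (v <= W)%MS && (dotv p0 v != 0)].
    exists v => // w wW; rewrite dotvDl (iso2 _ _ wW vW) addr0 v0 orbT //.
  (* As W is totally isotropic and [p0] has norm t != 0, [p0] is not in W. Then 2 (d - l) + 1 <= d,
     whereas l = |B| - 1 and 2 |B| <= d + 2. *)
  exfalso.
  have perp0 v : (v <= W)%MS -> dotv p0 v = 0.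
    move=> vW; apply/eqP; apply: contraNT perp => v0; apply/existsP; exists v.
    by rewrite vW.
  have M0 : (col_mx W p0) *m W^T = 0.
    rewrite mul_col_mx; apply/eqP; rewrite col_mx_eq0; apply/andP; split.
      apply/eqP/matrixP => i j; rewrite mxE [RHS]mxE.
      rewrite (_ : \sum_k _ = dotv (row i W) (row j W)); last first.
        by apply: eq_bigr => k _; rewrite !mxE.
      by apply: iso2; exact: row_sub.
    apply/eqP/matrixP => i j; rewrite mxE [RHS]mxE.
    rewrite (_ : \sum_k _ = dotv p0 (row j W)); last first.
      by apply: eq_bigr => k _; rewrite !mxE ord1.
    by apply: perp0; exact: row_sub.
  have := mulmx0_rank_max M0; rewrite mxrank_tr rW -addsmxE.
  have : (\rank W < \rank (W + p0)%MS)%N.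
    apply: rank_ltmx; rewrite ltmxE addsmxSl addsmx_sub submx_refl /=.
    apply/negP => /iso0 h; move: t0; rewrite -p0t h eqxx //.
  rewrite rW; move: (\rank _) => rk; lia.
have lines y : (#|[set c : F | y - c *: v \in X]%R| <= 2)%N.
  have [->|[c0]] := set_0Vmem [set c : F | y - c *: v \in X]; first by rewrite cards0.
  rewrite inE => c0X.
  have yW : (y - z0 - p0 <= W)%MS.
    have -> : y - z0 - p0 = (y - c0 *: v - p) + c0 *: v.
      by rewrite /p0; apply/rowP => i; rewrite !mxE; ring.
    by rewrite addmx_sub ?XW // scalemx_sub.
  pose P : {poly F} := (qnorm v) *: 'X^2 - (2%:R * dotv (y - z0) v) *: 'X + (qnorm (y - z0) - t)%:P.
  have P0 : P != 0.
    have := vP _ yW; rewrite addrC subrK; apply: contraTneq => P0.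
    have e2 := congr1 (fun s : {poly F} => s`_2) P0.
    have e1 := congr1 (fun s : {poly F} => s`_1) P0.
    move: e1 e2; rewrite /P !coefE /= !(mulr0, mulr1, subr0, addr0, sub0r, add0r, oppr0).
    move=> /eqP; rewrite oppr_eq0 mulf_eq0 (negbTE two0) /= => /eqP -> ->.
    by rewrite eqxx.
  have sP : (size P <= 3)%N.
    apply: (leq_trans (size_polyD _ _)); rewrite geq_max; apply/andP; split; last first.
      exact: leq_trans (size_polyC_leq1 _) _.
    apply: (leq_trans (size_polyD _ _)); rewrite geq_max size_polyN; apply/andP; split.
      by apply: (leq_trans (size_scale_leq _ _)); rewrite size_polyXn.
    by apply: (leq_trans (size_scale_leq _ _)); rewrite size_polyX.
  rewrite cardE -ltnS; apply: leq_trans sP; apply: max_poly_roots => //; last exact: enum_uniq.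
  apply/allP => c; rewrite mem_enum !inE => /forall_inP/(_ _ z0B)/eqP ct.
  rewrite rootE /P !(hornerD, hornerN, hornerZ, hornerXn, hornerX, hornerC) -{}ct.
  have -> : y - c *: v - z0 = (y - z0) - c *: v by rewrite addrAC.
  rewrite (qnormB (y - z0)) dotvZr qnormZ; apply/eqP; ring.
pose Y := [set p + w | w in rowg W].
have cY : #|Y| = (q ^ (d - l))%N.
  by rewrite card_imset ?card_rowg ?rW //; exact: addrI.
(* Double counting: the q translates of X along [v] stay in the coset Y and cover each of its points
   at most twice. *)
have key : (#|X| * q <= 2 * #|Y|)%N.
  rewrite -[q]cardsT -cardsX -sum1_card (partition_big (fun u => u.1 + u.2 *: v) (mem Y)) /=.
    rewrite mulnC -sum_nat_const; apply: leq_sum => y _.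
    apply: leq_trans (lines y).
    rewrite sum1_card -(card_in_imset (f := snd)).
      apply/subset_leq_card/subsetP => c /imsetP[[x c']].
      rewrite unfold_in /= !inE => /andP[/andP[xX _] /eqP <-] ->.
      by rewrite addrK.
    move=> [x c] [x' c'] /andP[_ /= /eqP e] /andP[_ /= /eqP e'] /= ec.
    by move: e; rewrite -e' ec => /addIr->.
  case=> x c; rewrite !inE /= => /andP[xX _]; apply/imsetP.
  exists (x - p + c *: v); last by apply/rowP => i; rewrite !mxE; ring.
  by rewrite mem_rowg addmx_sub ?scalemx_sub // XW // inE.
have ql : (d - l = (d - #|B|).+1)%N by rewrite Bl; move: Bd; rewrite Bl; lia.
move: key; rewrite cY ql expnS mulnCA mulnC leq_pmul2l //.
exact: ltnW (finNzRing_gt1 F).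
Qed.

End Affine.

(** * Shattering from clusters *)

Section Clusters.
Local Open Scope nat_scope.

Lemma leq_card_bigcup (I T : finType) (S : pred I) (G : I -> {set T}) :
  #|\bigcup_(i | S i) G i| <= \sum_(i | S i) #|G i|.
Proof.
elim/big_rec2: _ => [|i n U _ IH]; first by rewrite cards0.
by apply: leq_trans (leq_card_setU _ _) _; rewrite leq_add2l.
Qed.

Section UpdateCount.
Variables (k : nat) (V : finType) (P : {set V}).
Local Notation p := #|P|.
Local Notation T := {ffun 'I_k -> V}.

Definition tuples_in : {set T} := [set f : T | f \in ffun_on (mem P)].
Local Notation Omega := tuples_in.

Lemma tuples_inP (f : T) : reflect (forall i, f i \in P) (f \in Omega).
Proof. by rewrite inE; apply: ffun_onP. Qed.

Lemma card_tuples_in : #|Omega| = p ^ k.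
Proof. by rewrite cardsE card_ffun_on card_ord. Qed.

Definition update (g : T) (i : 'I_k) (x : V) : T := [ffun j => if j == i then x else g j].

(** Resampling of one coordinate: exchanging the [i]-th entry of a tuple with an extra point of [P]
    is injective, so [Phi] has density at most b/p if each tuple has at most [b] updates in it. *)
Lemma update_count (Phi : {set T}) (i : 'I_k) (b : nat) :
  Phi \subset Omega -> (forall g, g \in Omega -> #|[set x in P | update g i x \in Phi]| <= b) ->
  #|Phi| * p <= b * p ^ k.
Proof.
move=> sub bnd; rewrite -cardsX -card_tuples_in mulnC.
pose D := [set u : T * V | (u.1 \in Omega) && ((u.2 \in P) && (update u.1 i u.2 \in Phi))].
have cD : #|D| <= #|Omega| * b.
  rewrite -sum1_card (partition_big fst (mem Omega)) /=; last by move=> u; rewrite inE => /andP[].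
  rewrite -sum_nat_const; apply: leq_sum => g gO; apply: leq_trans (bnd g gO).
  rewrite sum1_card -(card_in_imset (f := snd)).
    apply/subset_leq_card/subsetP => x /imsetP[[g' x']].
    by rewrite unfold_in /= !inE /= => /andP[/andP[_ H] /eqP <-] ->.
  by move=> [g1 x1] [g2 x2] /andP[_ /= /eqP->] /andP[_ /= /eqP->] /= ->.
apply: leq_trans cD.
pose h (u : T * V) := (update u.1 i u.2, u.1 i).
have h_inj : injective h.
  move=> [f x] [f' x'] /= [/ffunP e ei]; congr (_, _); last first.
    by have := e i; rewrite !ffunE eqxx.
  apply/ffunP => j; have := e j; rewrite !ffunE.
  by case: eqP => [->|].
rewrite -[#|setX Phi P|](card_imset _ h_inj); apply/subset_leq_card/subsetP => w /imsetP[[f x]].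
rewrite in_setX => /andP[/= fPhi xP] ->.
have /tuples_inP fO := subsetP sub f fPhi.
rewrite inE /= fO; apply/andP; split.
  by apply/tuples_inP => j; rewrite ffunE; case: ifP.
rewrite (_ : update _ _ _ = f) //; apply/ffunP => j; rewrite !ffunE.
by case: eqP => [->|].
Qed.

End UpdateCount.

Section Shattering.
Variables (V : finType) (e : rel V) (k : nat).
Hypotheses (e_sym : symmetric e) (e_irr : irreflexive e).
Local Notation N := (neighborhood e).
Local Notation CN := (common_neighbors e).
Local Notation T := {ffun 'I_k -> V}.

Lemma common_neighborsP (S : {set V}) z : reflect (forall x, x \in S -> e x z) (z \in CN S).
Proof.
apply: (iffP bigcapP) => [h x xS|h x xS]; first by have := h x xS; rewrite inE.
by rewrite inE h.
Qed.

Lemma common_neighborsC (S : {set V}) z : (z \in CN S) = (S \subset N z).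
Proof.
apply/common_neighborsP/subsetP => h x xS; first by rewrite inE e_sym h.
by have := h x xS; rewrite inE e_sym.
Qed.

Lemma vc_dim_ge (f : T) : injective f ->
  (forall A : {set 'I_k}, exists z, forall i, (f i \in closed_neighborhood e z) = (i \in A)) ->
  k <= graph_vc_dim e.
Proof.
move=> f_inj sh; pose S := f @: [set: 'I_k].
have cS : #|S| = k by rewrite card_imset // cardsT card_ord.
rewrite -[X in X <= _]cS /graph_vc_dim /vc_dim.
apply: leq_bigmax_cond; rewrite /shatters eqEsubset subsetT /=.
apply/subsetP => g _.
pose A := [set i | if insub (f i) is Some u then g u else false].
have [z hz] := sh A; apply/imsetP; exists [ffun y => y \in closed_neighborhood e z].
  by apply/imsetP; exists z.
apply/ffunP => u; rewrite !ffunE.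
have /imsetP[i _ ei] := valP u; rewrite ei hz inE.
rewrite -ei valK //.
Qed.

Variables (P : {set V}) (y : V).
Hypotheses (k_gt0 : 0 < k) (yP : y \in CN P).
Local Notation p := #|P|.
(** Equal to 8 k 2^k: the k^2 collision events of density 1/M and the k 2^k hit events of density
    2/M then total at most 1/8 + 2/8. *)
Local Notation M := (2 ^ (k + 3) * k).
Hypotheses (p_big : M <= p).
Hypothesis dich : forall z, P \subset N z \/ M * #|N z :&: P| < p.

Definition bad_subsets (j : nat) : {set {set V}} :=
  [set B : {set V} | [&& B \subset P, #|B| == j & CN B \subset CN P]].

(* The default value y is irrelevant: see [separatorP]. *)
Definition separator (S : {set V}) : V := odflt y [pick z in CN S :\: CN P].

Local Notation Omega := (tuples_in k P).

Definition collisions (i i' : 'I_k) : {set T} := [set f in Omega | f i == f i'].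

(** The separator of [f @: A] is meant to realize the pattern [A]; for [i] outside [A] this fails
    exactly when [f i] is equal or adjacent to it. *)
Definition hits (A : {set 'I_k}) (i : 'I_k) : {set T} :=
  [set f in Omega | ~~ (CN (f @: A) \subset CN P) &&
     (f i \in closed_neighborhood e (separator (f @: A)))].

Definition absorbed (A : {set 'I_k}) : {set T} :=
  [set f in Omega | dinjectiveb f (mem A) && (CN (f @: A) \subset CN P)].

Lemma separatorP (S : {set V}) : ~~ (CN S \subset CN P) ->
  separator S \in CN S /\ M * #|N (separator S) :&: P| < p.
Proof.
case/subsetPn => z zS zP; rewrite /separator; case: pickP => [w|/(_ z)] /=; last first.
  by rewrite inE zS zP.
rewrite inE => /andP[wP wS]; split=> //.
by have [|//] := dich w; rewrite -common_neighborsC (negbTE wP).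
Qed.

Lemma collisions_count i i' : i != i' -> M * #|collisions i i'| <= p ^ k.
Proof.
move=> ii; have p0 : 0 < p by apply: leq_trans p_big; rewrite muln_gt0 expn_gt0.
have := @update_count k V P (collisions i i') i 1.
rewrite mul1n => h; rewrite -(leq_pmul2r p0) -mulnA [p ^ k * p]mulnC.
apply: leq_mul => //; apply: h.
  by apply/subsetP => f; rewrite inE => /andP[].
move=> g gO; apply: (@leq_trans #|[set g i']|); last by rewrite cards1.
apply/subset_leq_card/subsetP => x; rewrite !inE !ffunE eqxx eq_sym.
by rewrite eq_sym [i' == i]eq_sym (negbTE ii) => /andP[_ /andP[]].
Qed.

(** For [i] outside [A] the separator does not change when coordinate [i] is resampled, and its
    closed neighborhood has at most p/M + 1 <= 2p/M points in [P]. *)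
Lemma hits_count (A : {set 'I_k}) i : i \notin A -> M * #|hits A i| <= 2 * p ^ k.
Proof.
move=> iA; have p0 : 0 < p by apply: leq_trans p_big; rewrite muln_gt0 expn_gt0.
rewrite -(leq_pmul2r p0) -mulnA.
suff h : #|hits A i| * p <= (p.*2 %/ M) * p ^ k.
  apply: (leq_trans (leq_mul (leqnn M) h)).
  have -> : 2 * p ^ k * p = p.*2 * p ^ k by rewrite -mul2n mulnAC.
  by rewrite mulnA leq_mul2r mulnC leq_trunc_div orbT.
apply: (@update_count k V P (hits A i) i).
  by apply/subsetP => f; rewrite inE => /andP[].
move=> g gO.
have M0 : 0 < M by rewrite muln_gt0 expn_gt0.
have im x : update g i x @: A = g @: A.
  apply: eq_in_imset => j jA; rewrite ffunE; case: eqP => // ji.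
  by move: iA; rewrite -ji jA.
have [sub|nsub] := boolP (CN (g @: A) \subset CN P).
  rewrite (_ : [set x in P | _] = set0) ?cards0 //.
  by apply/setP => x; rewrite !inE im sub /= !andbF.
have [_ small] := separatorP nsub; set z := separator _ in small.
rewrite leq_divRL //.
have le1 : #|[set x in P | update g i x \in hits A i]| <= #|N z :&: P| + 1.
  rewrite -(cards1 z); apply: leq_trans (leq_card_setU _ _).
  apply/subset_leq_card/subsetP => x; rewrite !inE im -/z !ffunE eqxx.
  by case/and4P => -> _ _ /orP[->|->]; rewrite ?orbT ?andbT.
apply: (leq_trans (leq_mul le1 (leqnn M))); rewrite mulnDl mul1n -addnn mulnC.
by apply: leq_add => //; exact: ltnW.
Qed.

(** An absorbed tuple sends [A] onto a bad subset, which leaves at most j^j <= k^k choices inside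
    [A] and [p] for each index outside. *)
Lemma absorbed_count (A : {set 'I_k}) :
  #|absorbed A| <= #|bad_subsets #|A| | * (k ^ k * p ^ (k - #|A|)).
Proof.
set j := #|A|.
have jk : j <= k by rewrite -[k in _ <= k]card_ord max_card.
pose Fam (B : {set V}) : {set T} :=
  [set f : T | f \in family (fun i => if i \in A then mem B else mem P)].
have cF (B : {set V}) : #|B| = j -> #|Fam B| <= k ^ k * p ^ (k - j).
  move=> cB; rewrite cardsE card_family.
  have -> : foldr muln 1 [seq #|(if i \in A then mem B else mem P)| | i : 'I_k]
     = \prod_(i < k) (if i \in A then j else p).
    rewrite foldrE big_image /=; apply: eq_bigr => i _; case: ifP => // _.
  rewrite (bigID (mem A)) /= (eq_bigr (fun=> j)) => [|i ->//].
  rewrite prod_nat_const -/j (eq_bigr (fun=> p)) => [|i /negbTE->//].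
  have cC : #|[predC A]| = k - j by rewrite -[k in RHS]card_ord -(cardC A) addKn.
  rewrite prod_nat_const; apply: leq_mul.
    have [->|j0] := posnP j; first by rewrite expn0 expn_gt0 k_gt0.
    by apply: (@leq_trans (k ^ j)); [rewrite leq_exp2r | rewrite leq_pexp2l].
  by rewrite -cC; apply/eq_leq; congr (p ^ _); apply: eq_card => i; rewrite !inE.
have : absorbed A \subset \bigcup_(B in bad_subsets j) Fam B.
  apply/subsetP => f; rewrite inE => /and3P[/tuples_inP fP /dinjectiveP inj sub].
  apply/bigcupP; exists (f @: A).
    rewrite inE sub andbT card_in_imset // eqxx andbT.
    by apply/subsetP => _ /imsetP[i _ ->].
  rewrite inE; apply/familyP => i; case: ifP => // iA; exact: imset_f.
move/subset_leq_card/leq_trans; apply.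
apply: leq_trans (leq_card_bigcup _ _) _.
rewrite -sum_nat_const; apply: leq_sum => B; rewrite inE => /and3P[_ /eqP cB _].
exact: cF.
Qed.

(* A k-tuple of points of P outside all collisions, hits and absorbed sets is shattered: y
   realizes the full set and the separators realize the proper subsets.  By [dich] collisions
   and hits account for at most 3/8 of all k-tuples. *)
Lemma bad_subsets_many : ~~ (k <= graph_vc_dim e) ->
  exists2 j, 1 <= j < k & p ^ j <= 2 ^ k.+1 * k ^ k * #|bad_subsets j|.
Proof.
move=> novc; have p0 : 0 < p by apply: leq_trans p_big; rewrite muln_gt0 expn_gt0.
pose U1 := \bigcup_(u : 'I_k * 'I_k | u.1 != u.2) collisions u.1 u.2.
pose U2 := \bigcup_(u : {set 'I_k} * 'I_k | u.2 \notin u.1) hits u.1 u.2.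
pose U3 := \bigcup_(A : {set 'I_k} | A != setT) absorbed A.
have cover : Omega \subset U1 :|: U2 :|: U3.
  apply/subsetP => f fO; apply: contraR novc; rewrite !inE !negb_or => /andP[/andP[n1 n2] n3].
  have f_inj : injective f.
    move=> i i' eii; apply/eqP; apply: contraR n1 => ii.
    by apply/bigcupP; exists (i, i') => //; rewrite inE fO /= eii.
  have nabs (A : {set 'I_k}) : A != setT -> ~~ (CN (f @: A) \subset CN P).
    move=> AT; apply: contra n3 => sub; apply/bigcupP; exists A => //.
    by rewrite inE fO sub andbT; apply/dinjectiveP => i i' _ _; exact: f_inj.
  apply: (vc_dim_ge f_inj) => A; have [->|AT] := eqVneq A setT.
    exists y => i; rewrite in_setT !inE; apply/orP; right.
    by rewrite e_sym; move/common_neighborsP: yP; apply; move/tuples_inP: fO.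
  have [zS _] := separatorP (nabs A AT).
  exists (separator (f @: A)) => i; have [iA|iA] := boolP (i \in A).
    rewrite !inE; apply/orP; right; rewrite e_sym.
    by move/common_neighborsP: zS; apply; exact: imset_f.
  apply/negbTE; apply: contra n2 => hit; apply/bigcupP; exists (A, i) => //.
  by rewrite inE fO nabs.
have c2k : 2 ^ k = #|{: {set 'I_k}}|.
  by rewrite -cardsT -powersetT card_powerset cardsT card_ord.
have c1 : M * #|U1| <= (k * k) * p ^ k.
  apply: (@leq_trans (M * \sum_(u : 'I_k * 'I_k | u.1 != u.2) #|collisions u.1 u.2|)).
    by rewrite leq_mul2l leq_card_bigcup orbT.
  have -> : k * k = #|{: 'I_k * 'I_k}| by rewrite card_prod card_ord.
  rewrite big_distrr /= -sum_nat_const.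
  rewrite [X in _ <= X](bigID (fun u : 'I_k * 'I_k => u.1 != u.2)) /=.
  by apply: (leq_trans _ (leq_addr _ _)); apply: leq_sum => u; exact: collisions_count.
have c2 : M * #|U2| <= (2 ^ k * k) * (2 * p ^ k).
  apply: (@leq_trans (M * \sum_(u : {set 'I_k} * 'I_k | u.2 \notin u.1) #|hits u.1 u.2|)).
    by rewrite leq_mul2l leq_card_bigcup orbT.
  have -> : 2 ^ k * k = #|{: {set 'I_k} * 'I_k}|.
    by rewrite card_prod card_ord -c2k.
  rewrite big_distrr /= -sum_nat_const.
  rewrite [X in _ <= X](bigID (fun u : {set 'I_k} * 'I_k => u.2 \notin u.1)) /=.
  by apply: (leq_trans _ (leq_addr _ _)); apply: leq_sum => u; exact: hits_count.
have tot : p ^ k <= 2 * #|U3|.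
  have : p ^ k <= #|U1| + #|U2| + #|U3|.
    rewrite -(card_tuples_in k P); apply: leq_trans (subset_leq_card cover) _.
    apply: leq_trans (leq_card_setU _ _) _; rewrite leq_add2r; exact: leq_card_setU.
  have k2 : k < 2 ^ k by rewrite ltn_expl.
  have K0 : 0 < k * 2 ^ k by rewrite muln_gt0 k_gt0 expn_gt0.
  have ME : M = 8 * (k * 2 ^ k) by rewrite expnD -[2 ^ 3]/8; lia.
  have kk : k * k <= k * 2 ^ k by rewrite leq_mul2l ltnW ?orbT.
  have c12 : 8 * (#|U1| + #|U2|) <= 3 * p ^ k.
    rewrite -(leq_pmul2l K0).
    have : k * k * p ^ k <= k * 2 ^ k * p ^ k by rewrite leq_mul2r kk orbT.
    by move: c1 c2; rewrite ME; lia.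
  by lia.
have [A AT cA] : exists2 A : {set 'I_k}, A != setT & p ^ k <= 2 ^ k.+1 * #|absorbed A|.
  apply/exists_inP; apply: contraT; rewrite negb_exists_in => /forall_inP small.
  have : 2 ^ k.+1 * #|U3| < 2 ^ k * p ^ k.
    apply: (@leq_ltn_trans (2 ^ k.+1 * \sum_(A : {set 'I_k} | A != setT) #|absorbed A|)).
      by rewrite leq_mul2l leq_card_bigcup orbT.
    have -> : 2 ^ k * p ^ k = \sum_(A : {set 'I_k}) p ^ k by rewrite sum_nat_const -c2k.
    rewrite big_distrr /= [X in _ < X](bigD1 setT) //=.
    have le : \sum_(A : {set 'I_k} | A != setT) 2 ^ k.+1 * #|absorbed A|
        <= \sum_(A : {set 'I_k} | A != setT) p ^ k.
      by apply: leq_sum => A AT; apply: ltnW; rewrite ltnNge small.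
    by apply: (leq_ltn_trans le); rewrite -[X in X < _]add0n ltn_add2r expn_gt0 p0.
  by rewrite expnS [2 * _]mulnC -mulnA ltn_pmul2l ?expn_gt0 // ltnNge tot.
(* Every vertex is a common neighbor of the empty set, but a vertex of [P] is not adjacent to
   itself. *)
have A0 : 0 < #|A|.
  rewrite lt0n cards_eq0; apply: contraTneq cA => A0.
  rewrite (_ : absorbed A = set0) ?cards0 ?muln0 -?ltnNge ?expn_gt0 ?p0 //.
  apply/setP => f; rewrite [RHS]inE; apply/negbTE; rewrite inE !negb_and; apply/orP; right.
  apply/orP; right; apply/negP => /subsetP sub; have /card_gt0P[x xP] := p0.
  have := sub x; rewrite A0 imset0 /common_neighbors big_set0 inE => /(_ isT).
  by move/common_neighborsP/(_ x xP); rewrite e_irr.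
have Ak : #|A| < k.
  rewrite -[k in _ < k]card_ord -cardsT; apply: proper_card.
  by rewrite properEneq AT subsetT.
exists #|A|; first by rewrite A0.
have := leq_trans cA (leq_mul (leqnn _) (absorbed_count A)).
rewrite -{1}(subnKC (ltnW Ak)) expnD.
set b := #|bad_subsets _|; set r := p ^ (k - #|A|) => h.
have r0 : 0 < r by rewrite expn_gt0 p0.
rewrite -(leq_pmul2r r0); apply: (leq_trans h).
by apply/eq_leq; lia.
Qed.

End Shattering.

End Clusters.

(** * Distance graphs *)

Section DistanceGraph.
Variables (F : finFieldType) (d : nat) (E : {set 'rV[F]_d}) (t : F).
Local Notation q := #|F|.
Local Notation V := {x : 'rV[F]_d | x \in E}.
Local Notation e := (distance_graph E t).
Local Notation N := (neighborhood e).
Local Notation CN := (common_neighbors e).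
Hypotheses (q_odd : odd q) (t0 : t != 0) (d_gt0 : (0 < d)%N).

Lemma distance_graph_sym : symmetric e.
Proof. by move=> x y; rewrite /distance_graph -qnormN opprB. Qed.

Lemma distance_graph_irr : irreflexive e.
Proof.
move=> x; rewrite /distance_graph subrr; apply/negbTE; rewrite eq_sym.
rewrite /qnorm big1 // => i _; by rewrite mxE expr0n.
Qed.

Lemma card_common_neighbors_bound (P : {set V}) (B : {set 'rV[F]_d}) :
  B \subset val @: CN P -> affinely_independent B -> (0 < #|B|)%N -> (2 * #|B| <= d + 2)%N ->
  (#|P| <= 2 * q ^ (d - #|B|))%N.
Proof.
move=> sB indB B0 Bd.
apply: leq_trans (sphere_section_bound (odd_card_two_neq0 q_odd) d_gt0 t0 indB B0 Bd).
rewrite -(card_imset _ val_inj); apply/subset_leq_card/subsetP => _ /imsetP[x xP ->].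
rewrite inE; apply/forall_inP => _ /(subsetP sB)/imsetP[z zP ->].
by have /common_neighborsP/(_ x xP) := zP.
Qed.

(* P is the set of common neighbors of an affinely independent B containing y, of maximal size
   subject to losing at most a factor M per point.  If z is adjacent to a fraction 1/M of P
   then z lies in the affine span of B by maximality, hence is adjacent to all of P. *)
Lemma cluster_exists (M r : nat) (y : V) :
  (0 < M)%N -> (0 < r)%N -> (2 * r <= d + 2)%N -> (M ^ r * (2 * q ^ (d - r)) < #|N y|)%N ->
  exists P : {set V}, [/\ y \in CN P, (#|N y| <= M ^ r * #|P|)%N,
    forall z, P \subset N z \/ (M * #|N z :&: P| < #|P|)%N & (aff (val @: CN P) < r)%N].
Proof.
move=> M0 r0 rd big.
pose ok (B : {set V}) := [&& y \in B, affinely_independent (val @: B), (#|B| <= r)%N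
  & (#|N y| <= M ^ #|B| * #|CN B|)%N].
have CN1 : CN [set y] = N y by rewrite /common_neighbors big_set1.
have ok1 : ok [set y].
  rewrite /ok set11 imset_set1 affinely_independent1 cards1 r0 CN1 expn1 /=.
  by rewrite leq_pmull.
case: (@arg_maxnP _ [set y] ok (fun B : {set V} => #|B|) ok1) => B /and4P[yB indB Br big_B] maxB.
set P := CN B in big_B.
have yP : y \in CN P.
  apply/common_neighborsP => x /common_neighborsP/(_ y yB).
  by rewrite distance_graph_sym.
have BCN : B \subset CN P.
  apply/subsetP => b bB; apply/common_neighborsP => x /common_neighborsP/(_ b bB).
  by rewrite distance_graph_sym.
have NP : (#|N y| <= M ^ r * #|P|)%N.
  by apply: leq_trans big_B _; rewrite leq_mul2r leq_pexp2l ?orbT.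
have bigP : (2 * q ^ (d - r) < #|P|)%N.
  have := leq_trans big NP; rewrite ltn_pmul2l // expn_gt0 M0 //.
have affP : (aff (val @: CN P) < r)%N.
  rewrite ltnNge; apply/negP => /aff_subset[C [CP indC cC]].
  have := card_common_neighbors_bound CP indC; rewrite cC => /(_ r0 rd).
  by rewrite leqNgt bigP.
exists P; split=> // z.
have [small|large] := ltnP (M * #|N z :&: P|)%N #|P|; [by right | left].
(* One neighbor of [z] in [P] suffices: all points of [P] are at distance t from each point of [B],
   so on the affine span of [B] they agree about being at distance t. *)
have [a aNP] : exists a, a \in N z :&: P.
  apply/card_gt0P; rewrite lt0n; apply: contraTneq large => ->.
  by rewrite muln0 -ltnNge (leq_ltn_trans _ bigP).
move: (aNP); rewrite !in_setI => /andP[az aP].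
have span : ~~ affinely_independent (val z |: val @: B) \/ val z \in val @: B.
  have [zB|zB] := boolP (z \in B); first by right; exact: imset_f.
  left; apply/negP => indz.
  (* [B] lies in [CN P], whose affine rank is below [r], so there is room for one more point. *)
  have Br' : (#|B| < r)%N.
    apply: leq_trans affP; rewrite ltnS -(card_imset _ val_inj).
    by apply: aff_ge indB; exact: imsetS.
  have okz : ok (z |: B).
    rewrite /ok cardsU1 zB add1n Br' in_setU1 yB orbT imsetU1 indz /=.
    have -> : CN (z |: B) = N z :&: P by rewrite /common_neighbors bigcap_setU big_set1.
    by apply: leq_trans big_B _; rewrite expnSr -mulnA leq_mul2l large orbT.
  by have := maxB _ okz; rewrite cardsU1 zB add1n /= ltnn.
apply/subsetP => x xP; rewrite inE /distance_graph -qnormN opprB; apply/eqP.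
apply: (sphere_affine_span indB span (y := val a)).
  move=> _ /imsetP[b bB ->]; split; rewrite -opprB qnormN.
    by have /common_neighborsP/(_ b bB)/eqP := xP.
  by have /common_neighborsP/(_ b bB)/eqP := aP.
by rewrite -opprB qnormN; move: az; rewrite inE => /eqP.
Qed.

Lemma card_vertices : #|{: V}| = #|E|.
Proof. by rewrite card_sig; apply: eq_card => x; rewrite inE. Qed.

(** The set U of low-degree vertices forms too few pairs with E, hence |U| |E| <= 16 q^(d+1) <=
    |E|^2 / 2. *)
Lemma low_degree_bound :
  (32 * q ^ d.+1 <= #|E| ^ 2)%N -> (2 * #|[set y : V | (2 * q * #|N y| < #|E|)%N]| <= #|E|)%N.
Proof.
set U := [set y | _] => bigE.
have [E0|E0] := posnP #|E|.
  suff -> : U = set0 by rewrite cards0.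
  by apply/setP => y; rewrite !inE E0 ltn0.
have := @few_sphere_pairs F d t (val @: U) E q_odd t0.
rewrite (card_imset _ val_inj).
have -> : #|sphere_pairs t (val @: U) E| = (\sum_(y in U) #|N y|)%N.
  pose D := [set p : V * V | (p.1 \in U) && e p.1 p.2].
  have cD : (\sum_(y in U) #|N y| = #|D|)%N.
    rewrite -[RHS]sum1_card (eq_bigl (fun p : V * V => (p.1 \in U) && (p.2 \in N p.1))); last first.
      by move=> p; rewrite !inE.
    rewrite -(pair_big_dep (mem U) (fun x y => y \in N x) (fun _ _ => 1%N)) /=.
    by apply: eq_bigr => y _; rewrite sum1_card.
  have inj : injective (fun p : V * V => (val p.1, val p.2)).
    by move=> [x1 x2] [y1 y2] /= [/val_inj-> /val_inj->].
  rewrite cD -(card_imset _ inj); apply: eq_card => -[x y]; rewrite inE in_setX /=.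
  apply/andP/imsetP => [[/andP[/imsetP[x' xU ->] yE] xy]|[[x' y']]].
    by exists (x', Sub y yE); rewrite ?SubK // inE xU /distance_graph SubK.
  rewrite inE /= => /andP[xU xy] [-> ->]; split=> //.
  by rewrite imset_f //=; exact: valP.
move=> h.
have : (2 * (q * \sum_(y in U) #|N y|) <= #|U| * #|E|)%N.
  rewrite mulnA big_distrr /= -sum_nat_const; apply: leq_sum => y; rewrite inE.
  exact: ltnW.
move/h => h2; rewrite -(leq_pmul2r E0) mulnn -mulnA; apply: leq_trans bigE.
by rewrite -[32%N]/(2 * 16)%N -mulnA leq_mul2l h2.
Qed.

Lemma card_neighbors_subsets (j : nat) : (#|[set B : {set V} | #|B| == j]| <= #|E| ^ j)%N.
Proof.
rewrite card_draws card_vertices.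
apply: (@leq_trans ('C(#|E|, j) * j`!)%N); first by rewrite leq_pmulr ?fact_gt0.
rewrite bin_ffact ffact_prod -[X in (_ <= _ ^ X)%N](card_ord j) -prod_nat_const.
by apply: leq_prod => i _; exact: leq_subr.
Qed.

End DistanceGraph.

(** * Counting pairs of a vertex and a subset of its neighborhood *)

Section Counting.
Local Open Scope nat_scope.

Section StarCount.
Variables (F : finFieldType) (d : nat) (E : {set 'rV[F]_d}) (t : F) (k r m : nat).
Local Notation q := #|F|.
Local Notation n := #|E|.
Local Notation V := {x : 'rV[F]_d | x \in E}.
Local Notation e := (distance_graph E t).
Local Notation N := (neighborhood e).
Local Notation CN := (common_neighbors e).
Local Notation M := (2 ^ (k + 3) * k).
Local Notation ck := (2 ^ k.+1 * k ^ k).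
Hypotheses (q_odd : odd q) (t0 : (t != 0)%R) (d_gt1 : 1 < d).
Hypotheses (k_gt0 : 0 < k) (r_gt1 : 1 < r) (rd : 2 * r <= d + 2) (m_gt0 : 0 < m).

Lemma field_card_gt0 : 0 < q. Proof. exact: ltnW (finNzRing_gt1 F). Qed.

Lemma card_exceptional_neighbors (A : {set 'rV[F]_d}) : aff A < r -> #|A| <= q ^ (r - 2).
Proof.
move=> Ar; apply: leq_trans (card_le_aff A) _.
by rewrite leq_pexp2l ?field_card_gt0 //; lia.
Qed.

(** The constant combines n <= 2 q M^r |P| with |P| <= 2 q^(d-2), the bound for the common neighbors
    of two points. *)
Definition narrow : bool := n <= 4 * M ^ r * q ^ d.-1.

(* An exceptional set inside a cluster P has two common neighbors z, z' adjacent to all of P,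
   so P lies on a section of codimension 2 and |E| is at most of order q^(d-1): exceptional
   sets matter only in this case. *)
Definition poor_sets (j : nat) : {set {set V}} :=
  [set B : {set V} | (#|B| == j) && (#|CN B| <= m)]
    :|: (if narrow then exceptional_sets E t r m j else set0).

Definition poor_at (j : nat) (y : V) : {set {set V}} := [set B in poor_sets j | y \in CN B].

(** Bounds the pairs (y, B) with B exceptional: the common neighbors of B have affine rank at most r
    - 1, so they lie in an affine space of dimension at most r - 2. *)
Definition narrow_pairs (j : nat) : nat :=
  if narrow then #|exceptional_sets E t r m j| * q ^ (r - 2) else 0.

Lemma sum_poor_at j : \sum_y #|poor_at j y| <= m * n ^ j + narrow_pairs j.
Proof.
have -> : \sum_y #|poor_at j y| = \sum_(B in poor_sets j) #|CN B|.
  under eq_bigr do rewrite -sum1_card.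
  under [RHS]eq_bigr do rewrite -sum1_card.
  rewrite (exchange_big_dep (mem (poor_sets j))) /=; last by move=> y B _; rewrite inE => /andP[].
  apply: eq_bigr => B BS; apply: eq_bigl => y; by rewrite inE BS.
apply: (@leq_trans (\sum_(B in [set B : {set V} | (#|B| == j) && (#|CN B| <= m)]) #|CN B|
   + \sum_(B in (if narrow then exceptional_sets E t r m j else set0)) #|CN B|)).
  rewrite /poor_sets; set S1 := [set B | _]; set S2 := (if _ then _ else _).
  rewrite big_mkcond [X in _ <= X + _]big_mkcond [X in _ <= _ + X]big_mkcond -big_split.
  apply: leq_sum => B _ /=; rewrite in_setU.
  by case: (B \in S1); case: (B \in S2); rewrite ?leq_addr ?leq_addl.
apply: leq_add.
  apply: (@leq_trans (\sum_(B in [set B : {set V} | (#|B| == j) && (#|CN B| <= m)]) m)).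
    by apply: leq_sum => B; rewrite inE => /andP[].
  rewrite sum_nat_const mulnC leq_mul2l; apply/orP; right.
  apply: leq_trans (card_neighbors_subsets E j); apply/subset_leq_card/subsetP => B.
  by rewrite !inE => /andP[].
rewrite /narrow_pairs; case: narrow; last by rewrite big_set0.
rewrite -sum_nat_const; apply: leq_sum => B; rewrite inE => /and3P[_ /andP[_ Br] _].
by rewrite -(card_imset _ val_inj); exact: card_exceptional_neighbors.
Qed.

(** If B has more than m >= 1 common neighbors, their affine rank is at least 2, and it is below r
    because they all lie in [CN P]. Two of them also confine P to a section of codimension 2, which
    puts n in the narrow range. *)
Lemma bad_subset_poor (P : {set V}) (y : V) (j : nat) :
  y \in CN P -> n <= 2 * q * M ^ r * #|P| -> aff (val @: CN P) < r ->
  bad_subsets e P j \subset poor_at j y.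
Proof.
move=> yP nP affP; apply/subsetP => B; rewrite inE => /and3P[BP /eqP cB sub].
have yB : y \in CN B.
  by apply/common_neighborsP => x xB; move/common_neighborsP: yP; apply; exact: (subsetP BP).
rewrite inE yB andbT in_setU inE cB eqxx /=.
have [//|mB] := leqP #|CN B| m.
have sub' : val @: CN B \subset val @: CN P by exact: imsetS.
have aff1 : 1 < aff (val @: CN B).
  rewrite ltnNge; apply: contraL mB => aff1; rewrite -leqNgt -(card_imset _ val_inj).
  apply: leq_trans (card_le_aff _) _; rewrite (_ : _.-1 = 0) ?expn0 //.
  by move: aff1; case: (aff _) => [|[]].
have -> : narrow.
  have [C [CP indC cC]] := aff_subset (leq_trans aff1 (affS sub')).
  have := card_common_neighbors_bound q_odd t0 (ltnW d_gt1) CP indC; rewrite cC.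
  rewrite -[2 * 2]/4 => /(_ isT) P2; have {}P2 := P2 (ltac:(clear -d_gt1; lia)).
  apply: leq_trans nP _; apply: leq_trans (leq_mul (leqnn _) P2) _.
  have -> : d.-1 = (d - 2).+1 by clear -d_gt1; lia.
  by rewrite expnS; apply/eq_leq; ring.
rewrite inE /= cB eqxx aff1 mB /= andbT.
exact: leq_ltn_trans (affS sub') affP.
Qed.

Hypotheses (big1 : 32 * q ^ d.+1 <= n ^ 2) (big2 : 4 * q * M ^ r * q ^ (d - r) < n)
  (big3 : 2 * q * M ^ r * M <= n).
Hypothesis novc : ~~ (k <= graph_vc_dim e).

Lemma poor_at_many (y : V) : n <= 2 * q * #|N y| ->
  exists2 j, 1 <= j < k & n ^ j <= (2 * q * M ^ r) ^ j * ck * #|poor_at j y|.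
Proof.
move=> ny; have M0 : 0 < M by rewrite muln_gt0 expn_gt0.
have q20 : 0 < 2 * q by rewrite muln_gt0 field_card_gt0.
have bigN : M ^ r * (2 * q ^ (d - r)) < #|N y|.
  rewrite -(ltn_pmul2l q20); apply: leq_trans ny; apply: leq_trans big2.
  by rewrite ltnS; apply/eq_leq; ring.
have [P [yP NP dich affP]] :=
  cluster_exists q_odd t0 (ltnW d_gt1) M0 (ltnW r_gt1) rd bigN.
have nP : n <= 2 * q * M ^ r * #|P|.
  by apply: leq_trans ny _; rewrite -[X in _ <= X]mulnA leq_mul2l NP orbT.
have MP : M <= #|P|.
  have c0 : 0 < 2 * q * M ^ r by rewrite muln_gt0 q20 expn_gt0 M0.
  by rewrite -(leq_pmul2l c0); exact: leq_trans nP.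
have [j jk bad] := bad_subsets_many (@distance_graph_sym F d E t) (distance_graph_irr t0)
  k_gt0 yP MP dich novc.
exists j => //; apply: (@leq_trans ((2 * q * M ^ r * #|P|) ^ j)).
  by rewrite leq_exp2r //; case/andP: jk.
rewrite expnMn -[X in _ <= X]mulnA leq_mul2l; apply/orP; right.
apply: leq_trans bad _; rewrite leq_mul2l; apply/orP; right.
exact/subset_leq_card/bad_subset_poor.
Qed.

(** At least n/2 vertices have degree n/(2q) or more, and a single j serves n/(2k) of them. Summing
    [poor_at_many] over these vertices yields the additional power of n. *)
Lemma star_inequality : exists2 j, 1 <= j < k &
  n ^ j.+1 <= 2 * k * ck * (2 * q * M ^ r) ^ j * (m * n ^ j + narrow_pairs j).
Proof.
have n0 : 0 < n by apply: leq_ltn_trans big2.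
pose Y := [set y : V | n <= 2 * q * #|N y|].
pose Yj (j : nat) := [set y : V | n ^ j <= (2 * q * M ^ r) ^ j * ck * #|poor_at j y|].
have cY : n <= 2 * #|Y|.
  have := low_degree_bound q_odd t0 big1.
  have := cardsC Y; rewrite card_vertices.
  have -> : ~: Y = [set y : V | 2 * q * #|N y| < n] by apply/setP => y; rewrite !inE ltnNge.
  lia.
have subY : Y \subset \bigcup_(j : 'I_k | 0 < j) Yj j.
  apply/subsetP => y; rewrite inE => /poor_at_many[j /andP[j1 jk] h].
  by apply/bigcupP; exists (Ordinal jk); rewrite ?inE.
have [j j0 cj] : exists2 j : 'I_k, 0 < j & n <= 2 * k * #|Yj j|.
  apply/exists_inP; apply: contraT; rewrite negb_exists_in => /forall_inP small.
  have : k * n < k * n; last by rewrite ltnn.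
  apply: (@leq_ltn_trans (2 * k * #|Y|)).
    by rewrite mulnAC [X in _ <= X]mulnC leq_mul2l cY orbT.
  apply: (@leq_ltn_trans (\sum_(j : 'I_k | 0 < j) 2 * k * #|Yj j|)).
    rewrite -big_distrr leq_mul2l; apply/orP; right.
    exact: leq_trans (subset_leq_card subY) (leq_card_bigcup _ _).
  apply: (@leq_ltn_trans (\sum_(j : 'I_k | 0 < j) n.-1)).
    by apply: leq_sum => j /small; rewrite -ltnNge; lia.
  apply: (@leq_ltn_trans (k * n.-1)).
    rewrite sum_nat_const leq_mul2r -[X in _ <= X](card_ord k) max_card orbT //.
  by rewrite ltn_pmul2l // prednK.
exists j; first by rewrite j0 /=.
rewrite expnS; apply: leq_trans (leq_mul cj (leqnn _)) _.
rewrite -!mulnA leq_mul2l /=; rewrite leq_mul2l; apply/orP; right.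
rewrite !mulnA; apply: (@leq_trans (\sum_(y in Yj j) (2 * q * M ^ r) ^ j * ck * #|poor_at j y|)).
  by rewrite -sum_nat_const; apply: leq_sum => y; rewrite inE.
apply: (@leq_trans (\sum_y (2 * q * M ^ r) ^ j * ck * #|poor_at j y|)).
  by rewrite [X in _ <= X](bigID (mem (Yj j))) leq_addr.
rewrite -big_distrr /=; apply: leq_trans (leq_mul (leqnn _) (sum_poor_at j)) _.
by apply/eq_leq; ring.
Qed.

End StarCount.

End Counting.

(** * The threshold *)

Lemma le_max_upto (R : realType) (k j : nat) (f : nat -> R) :
  (1 <= j < k)%N -> f j <= max_upto k f.
Proof. by move=> jk; apply: le_bigmax_seq => //; rewrite mem_index_iota. Qed.

Section Threshold.
Variables (R : realType) (k r d m : nat) (K : R).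
Local Notation M := (2 ^ (k + 3) * k)%N.
Local Notation ck := (2 ^ k.+1 * k ^ k)%N.
Local Notation A0 := (2 * k * ck * (2 * M ^ r) ^ k)%N.

(** The summands secure, in this order, enough vertices of large degree, the existence of clusters,
    clusters of size at least M, the negligibility of sets with at most m common neighbors, and that
    of exceptional sets. *)
Definition vc_threshold : R :=
  (32 + 4 * M ^ r + 2 * M ^ r * M + 2 * A0 * m)%N%:R + (8 * A0 * M ^ r)%N%:R * K.

Hypothesis K_gt0 : 0 < K.

Lemma vc_threshold_ge (c : nat) :
  (c <= 32 + 4 * M ^ r + 2 * M ^ r * M + 2 * A0 * m)%N -> c%:R <= vc_threshold.
Proof.
move=> h; apply: (@le_trans _ _ (32 + 4 * M ^ r + 2 * M ^ r * M + 2 * A0 * m)%N%:R).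
  by rewrite ler_nat.
by rewrite lerDl mulr_ge0 ?ler0n // ltW.
Qed.

Lemma vc_threshold_geK : (8 * A0 * M ^ r)%N%:R * K <= vc_threshold.
Proof. by rewrite lerDr ler0n. Qed.

Lemma vc_threshold_ge1 : 1 <= vc_threshold.
Proof. by apply: (@vc_threshold_ge 1); rewrite !addnA -addnA addSn. Qed.

End Threshold.

(** The exponent b = 2 + j - alpha is at least 1, so C^b >= C >= c and the same constant serves
    every alpha. *)
Lemma power_gap (R : realType) (n q alpha C c : R) (D j : nat) :
  1 <= q -> 0 <= alpha <= j%:R -> 1 <= C -> c <= C -> 0 < n ->
  C * q `^ (D%:R / (2 + j%:R - alpha)) < n -> c * q ^+ D * n `^ alpha < n ^+ j.+2.
Proof.
move=> q1 /andP[a0 aj] C1 cC n0 big.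
set b := 2 + j%:R - alpha in big *.
have b1 : 1 <= b by rewrite /b; lra.
have b0 : 0 < b by apply: lt_le_trans b1.
have C0 : 0 < C by apply: lt_le_trans C1.
have q0 : 0 < q by apply: lt_le_trans q1.
have -> : n ^+ j.+2 = n `^ b * n `^ alpha.
  rewrite -powR_mulrn ?ltW // -powRD; last by rewrite (gt_eqF n0) implybT.
  by congr (_ `^ _); rewrite /b subrK -natrD.
rewrite ltr_pM2r ?powR_gt0 //.
have -> : q ^+ D = (q `^ (D%:R / b)) `^ b.
  by rewrite -powRrM divfK ?gt_eqF // powR_mulrn ?ltW.
have Cq0 : 0 <= C * q `^ (D%:R / b) by rewrite mulr_ge0 ?powR_ge0 ?ltW.
apply: le_lt_trans (gt0_ltr_powR b0 Cq0 _ big); last by rewrite nnegrE ltW.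
rewrite powRM ?(ltW C0) ?powR_ge0 //; apply: ler_wpM2r; first exact: powR_ge0.
by apply: le_trans cC _; exact: le1r_powR.
Qed.

Theorem theorem1p11 (R : realType) (k r d m : nat)
    (hk : (3 <= k <= d)%N) (hm : (1 <= m <= d + 1)%N)
    (hr : (2 <= r)%N /\ (2 * r <= d + 2)%N)
    (amax amin K : R) (hK : 0 < K) :
  exists C : R, 0 < C /\
    forall alpha : nat -> R,
      (forall j : nat, (1 <= j < k)%N -> 0 <= alpha j <= j%:R) ->
      max_upto k alpha = amax ->
      min_upto k alpha = amin ->
      forall (F : finFieldType) (t : F) (E : {set 'rV[F]_d}),
        odd #|F| -> t != 0 ->
        (forall j : nat, (1 <= j < k)%N ->
           #|exceptional_sets E t r m j|%:R <= K * #|E|%:R `^ alpha j) ->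
        C * #|F|%:R `^ vc_exponent k r d alpha < #|E|%:R ->
        (k <= graph_vc_dim (distance_graph E t))%N.
Proof.
have [k3 kd] := andP hk; have [m1 _] := andP hm; have [r2 rd] := hr.
have d2 : (1 < d)%N by lia.
have k0 : (0 < k)%N by lia.
have k10 : (1 <= k.-1)%N by lia.
have rled : (r <= d)%N by lia.
have part (x y z w : nat) : [/\ x <= x + y + z + w, y <= x + y + z + w,
    z <= x + y + z + w & w <= x + y + z + w]%N by split; lia.
exists (vc_threshold k r m K); split.
  by apply: lt_le_trans (vc_threshold_ge1 k r m hK).
move=> alpha alphaP _ _ F t E q_odd t0 exc big.
apply: contraT => novc; exfalso.
set C := vc_threshold _ _ _ _ in big.
set s := vc_exponent _ _ _ _ in big.
set q := #|F| in q_odd exc big *; set n := #|E| in exc big *.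
set M := (2 ^ (k + 3) * k)%N.
set ck := (2 ^ k.+1 * k ^ k)%N.
set A0 := (2 * k * ck * (2 * M ^ r) ^ k)%N.
have [t1 t2 t3 t4] := part 32%N (4 * M ^ r)%N (2 * M ^ r * M)%N (2 * A0 * m)%N.
have q1 : (0 < q)%N by exact: ltnW (finNzRing_gt1 F).
have q1R : 1 <= q%:R :> R by rewrite ler1n.
have C1 : 1 <= C by exact: vc_threshold_ge1.
have C0 : 0 < C by apply: lt_le_trans C1.
have below x : x <= s -> C * q%:R `^ x < n%:R.
  by move=> xs; apply: le_lt_trans big; rewrite ler_pM2l // ler_powR.
have belown (c x : nat) : (c <= 32 + 4 * M ^ r + 2 * M ^ r * M + 2 * A0 * m)%N ->
    x%:R <= s -> (c * q ^ x < n)%N.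
  move=> cC xs; rewrite -(ltr_nat R) natrM natrX -powR_mulrn ?ler0n //.
  apply: le_lt_trans (below _ xs); rewrite ler_wpM2r ?powR_ge0 //.
  exact: vc_threshold_ge.
have n0 : (0 < n)%N.
  by rewrite -(ltr_nat R); apply: le_lt_trans big; rewrite mulr_ge0 ?powR_ge0 ?ltW.
have s1 : (d%:R + 1) / 2 <= s by rewrite /s /vc_exponent le_max lexx.
have s2 : (d - r).+1%:R <= s.
  by rewrite /s /vc_exponent !le_max -natr1 natrB // lexx !orbT.
have s3 : (k.-1)%:R <= s.
  by rewrite /s /vc_exponent !le_max -subn1 natrB // lexx !orbT.
have s4 j : (1 <= j < k)%N -> (d%:R + j%:R + r%:R - 3) / (2 + j%:R - alpha j) <= s.
  move=> jk; rewrite /s /vc_exponent !le_max.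
  by rewrite (le_max_upto (fun j => (d%:R + j%:R + r%:R - 3) / (2 + j%:R - alpha j)) jk) !orbT.
have big1 : (32 * q ^ d.+1 <= n ^ 2)%N.
  rewrite -(ler_nat R) natrM !natrX; set w : R := q%:R `^ ((d%:R + 1) / 2).
  have ew : w ^+ 2 = q%:R ^+ d.+1.
    rewrite -powR_mulrn ?powR_ge0 // -powRrM divfK ?pnatr_eq0 //.
    by rewrite natr1 powR_mulrn ?ler0n.
  have w0 : 0 <= w by exact: powR_ge0.
  have := below _ s1; rewrite -/w => lt_n.
  have C32 : 32 <= C by exact: vc_threshold_ge t1.
  have : (C * w) ^+ 2 <= n%:R ^+ 2.
    by rewrite ler_pXn2r ?nnegrE ?ler0n ?(ltW lt_n) // mulr_ge0 // ltW.
  apply: le_trans; rewrite exprMn ew ler_wpM2r ?exprn_ge0 ?ler0n //.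
  by rewrite expr2; nra.
have big2 : (4 * q * M ^ r * q ^ (d - r) < n)%N.
  have := belown _ (d - r).+1 t2 s2.
  by apply: leq_trans; rewrite ltnS expnS; apply/eq_leq; ring.
have big3 : (2 * q * M ^ r * M <= n)%N.
  have := belown _ k.-1 t3 s3.
  move=> h; apply: ltnW; apply: leq_trans h; rewrite ltnS.
  have -> : (2 * q * M ^ r * M = 2 * M ^ r * M * q)%N by ring.
  by rewrite leq_mul2l -{1}(expn1 q) leq_pexp2l ?orbT.
have [j jk star] := star_inequality q_odd t0 d2 k0 r2 rd m1 big1 big2 big3 novc.
rewrite -/q -/n -/M -/ck in star.
have [j1 jk'] := andP jk.
have M0 : (0 < M)%N by rewrite muln_gt0 expn_gt0.
have star2 : (n ^ j.+1 <= A0 * q ^ j * (m * n ^ j + narrow_pairs E t k r m j))%N.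
  apply: leq_trans star _; rewrite leq_mul2r; apply/orP; right.
  rewrite /A0 -[X in (_ <= X)%N]mulnA leq_mul2l; apply/orP; right.
  have -> : (2 * q * M ^ r = 2 * M ^ r * q)%N by ring.
  rewrite expnMn leq_mul2r leq_pexp2l ?orbT //; last exact: ltnW.
  by rewrite muln_gt0 expn_gt0 M0.
have small : (2 * (A0 * q ^ j * (m * n ^ j)) < n ^ j.+1)%N.
  have h := belown _ k.-1 t4 s3.
  have -> : (2 * (A0 * q ^ j * (m * n ^ j)) = 2 * A0 * m * q ^ j * n ^ j)%N by ring.
  rewrite expnS ltn_pmul2r ?expn_gt0 ?n0 //; apply: leq_ltn_trans h.
  by rewrite leq_mul2l leq_pexp2l ?orbT // -ltnS prednK.
have star3 : (n ^ j.+1 <= 2 * (A0 * q ^ j * narrow_pairs E t k r m j))%N.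
  move: star2 small; rewrite mulnDr.
  move: (A0 * q ^ j * (m * n ^ j))%N (A0 * q ^ j * narrow_pairs E t k r m j)%N (n ^ j.+1)%N.
  by clear; lia.
move: star3; rewrite /narrow_pairs; case: ifP => [nar|_]; last first.
  by rewrite !muln0 leqNgt expn_gt0 n0.
rewrite /narrow -/M -/q -/n in nar => star3.
(* The narrow bound on n supplies one more factor n at the price of q^(d-1); the total exponent of q
   is (d - 1) + j + (r - 2). *)
have star4 : (n ^ j.+2 <= 8 * A0 * M ^ r * q ^ (d + j + r - 3) * #|exceptional_sets E t r m j|)%N.
  rewrite expnS; apply: leq_trans (leq_mul nar star3) _.
  have -> : (d + j + r - 3 = d.-1 + (j + (r - 2)))%N by clear -d2 r2; lia.
  by rewrite !expnD; apply/eq_leq; ring.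
have n0R : 0 < n%:R :> R by rewrite ltr0n.
have DE : (d + j + r - 3)%N%:R = d%:R + j%:R + r%:R - 3 :> R.
  by rewrite natrB ?natrD //; clear -d2 r2; lia.
have gap := power_gap q1R (alphaP j jk) C1 (vc_threshold_geK k r m K) n0R.
have := gap (d + j + r - 3)%N; rewrite DE => /(_ (below _ (s4 j jk))).
apply/negP; rewrite -leNgt -/M -/ck -/A0.
apply: (@le_trans _ _ (8 * A0 * M ^ r * q ^ (d + j + r - 3) * #|exceptional_sets E t r m j|)%N%:R).
  by rewrite -natrX ler_nat.
rewrite natrM natrM natrX.
have -> : (8 * A0 * M ^ r)%N%:R * K * q%:R ^+ (d + j + r - 3) * n%:R `^ alpha j
  = (8 * A0 * M ^ r)%N%:R * q%:R ^+ (d + j + r - 3) * (K * n%:R `^ alpha j) by ring.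
by rewrite ler_wpM2l ?mulr_ge0 ?exprn_ge0 ?ler0n // exc.
Qed.
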